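(* Let $c_1\neq c_2$ be points in $[0,1]$ satisfying $$\frac13-\frac12(c_1+c_2)+c_1c_2=0,$$ and consider the scheme (EQRF2) $$y_{n+1}=e^{\tau A}y_n+\tau\varphi_1(\tau A)\alpha_{0,n}+\Gamma(1+r)\Bigl((t_n+\tau)^{1+r}\varphi_{1+r}\bigl((t_n+\tau)A\bigr)-t_n^{1+r}e^{\tau A}\varphi_{1+r}(t_nA)\Bigr)\alpha_{1,n},$$ $n=0,\dots,N-1$, started from the exact initial value $y_0$, where $$\alpha_{1,n}=\frac{h((t_n+c_2\tau)^r)-h((t_n+c_1\tau)^r)}{(t_n+c_2\tau)^r-(t_n+c_1\tau)^r},\qquad \alpha_{0,n}=h((t_n+c_1\tau)^r)-(t_n+c_1\tau)^r\alpha_{1,n}.$$ Assume $h$ is three times differentiable on $[0,\infty)$ with bounded derivatives $h',h'',h'''$, and that $h''(x)\in\mathcal{D}(A)$ for all $x\ge0$ with $x\mapsto Ah''(x)$ bounded. Then for all $N\in\mathbb{N}$ and $0\le n\le N$, $$\|y(t_n)-y_n\|\le C\tau^{1+2r},$$ where $C$ may depend on $T$ (and on $r,h,c_1,c_2$ and the semigroup) but not on $n$ or $\tau$.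
   Context: $(X,\|\cdot\|)$ is a Banach space and $A:\mathcal{D}(A)\subset X\to X$ is a linear operator generating a strongly continuous semigroup $\{e^{tA}\}_{t\ge0}$ on $X$. Fix $T>0$, $0<r<1$, $y_0\in X$ and $h:[0,\infty)\to X$. The problem is $y'(t)=Ay(t)+h(t^r)$, $y(0)=y_0$, $t\in[0,T]$, with (mild) solution $y(t)=e^{tA}y_0+\int_0^te^{(t-s)A}h(s^r)\,ds$. Time grid: $N\in\mathbb{N}$, $\tau=T/N$, $t_n=n\tau$. For $\lambda>0$ and $t\ge0$ the fractional $\varphi$ function is the bounded operator $\varphi_\lambda(tA)v=\frac{1}{\Gamma(\lambda)}\int_0^1e^{(1-\theta)tA}\theta^{\lambda-1}v\,d\theta$ ($v\in X$), $\Gamma$ being Euler's gamma function; in particular $\tau\varphi_1(\tau A)v=\int_0^\tau e^{(\tau-s)A}v\,ds$. Convention $0^{1+r}=0$. *)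

(* Defs.v *)
From Stdlib Require Import Reals.
From Coquelicot Require Import Coquelicot.
Open Scope R_scope.

(* Real powers on [0,oo): x^a for x > 0; convention 0^a = 0 for a <> 0, 0^0 = 1. *)
Definition rpow (x a : R) : R :=
  if Rlt_dec 0 x then Rpower x a else if Req_EM_T a 0 then 1 else 0.

Definition Gamma (l : R) : R :=
  RInt_gen (fun t => Rpower t (l - 1) * exp (- t)) (at_right 0) (Rbar_locally p_infty).

Section Semigroup.
Context {X : CompleteNormedModule R_AbsRing}.

Definition C0_semigroup (S : R -> X -> X) : Prop :=
  (forall t, 0 <= t -> forall x y, S t (plus x y) = plus (S t x) (S t y)) /\
  (forall t, 0 <= t -> forall (k : R) x, S t (scal k x) = scal k (S t x)) /\
  (forall t, 0 <= t -> exists M, forall x, norm (S t x) <= M * norm x) /\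
  (forall x, S 0 x = x) /\
  (forall t s, 0 <= t -> 0 <= s -> forall x, S (t + s) x = S t (S s x)) /\
  (forall x, filterlim (fun t => S t x) (at_right 0) (locally x)).

(* Graph of the generator A of S: x \in D(A) and A x = y iff
   (S t x - x)/t -> y as t -> 0+. *)
Definition gen_graph (S : R -> X -> X) (x y : X) : Prop :=
  filterlim (fun t => scal (/ t) (minus (S t x) x)) (at_right 0) (locally y).

Definition deriv_on_nonneg (f g : R -> X) : Prop :=
  forall x, 0 <= x ->
    filterlim (fun y => scal (/ (y - x)) (minus (f y) (f x)))
      (within (fun y => 0 <= y /\ y <> x) (locally x)) (locally (g x)).

Definition bounded_on_nonneg (f : R -> X) : Prop :=
  exists M, forall x, 0 <= x -> norm (f x) <= M.

Definition phi (S : R -> X -> X) (l t : R) (v : X) : X :=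
  scal (/ Gamma l) (RInt (fun th => scal (rpow th (l - 1)) (S ((1 - th) * t) v)) 0 1).

(* mild solution of y' = A y + h(t^r), y(0) = y0 *)
Definition mild_sol (S : R -> X -> X) (h : R -> X) (r : R) (y0 : X) (t : R) : X :=
  plus (S t y0) (RInt (fun s => S (t - s) (h (rpow s r))) 0 t).

Definition alpha1 (h : R -> X) (r c1 c2 tn tau : R) : X :=
  let p1 := rpow (tn + c1 * tau) r in
  let p2 := rpow (tn + c2 * tau) r in
  scal (/ (p2 - p1)) (minus (h p2) (h p1)).

Definition alpha0 (h : R -> X) (r c1 c2 tn tau : R) : X :=
  let p1 := rpow (tn + c1 * tau) r in
  minus (h p1) (scal p1 (alpha1 h r c1 c2 tn tau)).

Definition eqrf2_step (S : R -> X -> X) (h : R -> X) (r c1 c2 tau tn : R) (yn : X) : X :=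
  let a0 := alpha0 h r c1 c2 tn tau in
  let a1 := alpha1 h r c1 c2 tn tau in
  plus (plus (S tau yn) (scal tau (phi S 1 tau a0)))
    (scal (Gamma (1 + r))
      (minus (scal (rpow (tn + tau) (1 + r)) (phi S (1 + r) (tn + tau) a1))
             (scal (rpow tn (1 + r)) (S tau (phi S (1 + r) tn a1))))).

Fixpoint eqrf2 (S : R -> X -> X) (h : R -> X) (r c1 c2 tau : R) (y0 : X) (n : nat) : X :=
  match n with
  | O => y0
  | Datatypes.S m => eqrf2_step S h r c1 c2 tau (INR m * tau) (eqrf2 S h r c1 c2 tau y0 m)
  end.

End Semigroup.

(* Main.v *)
(** By Gamma 1 = 1 and Gamma (1 + r) <> 0, one step of the scheme is the variation-of-constants
    formula with h (s^r) replaced by its linear interpolant in the variable x = s^r at the nodes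
    p1, p2. The error therefore obeys e_(n+1) = S tau e_n + l_n, where l_n integrates the
    interpolation error, namely h''(p1) (x - p1) (x - p2) / 2 up to O(D^3), D being the variation
    of s^r over the step.
    On the first step D <= tau^r, so l_0 = O(tau^(1 + 2r)). On later steps D <= t^(r-1) tau, and
    linearising s^r at t turns (x - p1) (x - p2) into a multiple of
    (s - t - c1 tau) (s - t - c2 tau), whose integral vanishes by the condition on c1, c2;
    since h''(p1) lies in D(A), the semigroup may be replaced by the identity at the cost of
    another factor tau. This gives l_n = O(tau^4 t^(2r-3)) = O(tau^(1+2r) n^(2r-3)), which is
    summable because 2r - 3 < -1. *)
Require Import Defs.
From Stdlib Require Import Reals Lra Lia List.
From Stdlib Require Import Classical ClassicalEpsilon.
From Coquelicot Require Import Coquelicot.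
Open Scope R_scope.

(** * Vector identities and the mean value inequality *)

(** The estimate ||e_(n+1)|| <= M ||e_n|| + ||l_n|| would compound to M^n, so the induction bounds
    [S (m tau) e_n] for all m with n + m <= N instead. By the semigroup law every local error is
    then transported over its whole remaining time at once, at the cost of a single factor M. The
    uniform M on [0, T] has itself to be derived, since [C0_semigroup] bounds each operator
    separately; strong continuity supplies it through a Baire category argument. The third
    derivative of h is only bounded and may fail to be integrable, so Taylor remainders come from a
    mean value inequality in norm and not from an integral formula. The expansion is made in the
    variable x = s^r, in which h is smooth up to 0, whereas s^r has infinite slope at 0; this is why
    the step starting at 0 is estimated apart from the others. *)

Inductive vexp : Type :=
| VZero
| VVar (n : nat)
| VPlus (e f : vexp)
| VMinus (e f : vexp)
| VOpp (e : vexp)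
| VScal (k : R) (e : vexp).

Fixpoint vcoef (e : vexp) (n : nat) : R :=
  match e with
  | VZero => 0
  | VVar m => if Nat.eqb m n then 1 else 0
  | VPlus e f => vcoef e n + vcoef f n
  | VMinus e f => vcoef e n - vcoef f n
  | VOpp e => - vcoef e n
  | VScal k e => k * vcoef e n
  end.

Fixpoint vdenote {X : NormedModule R_AbsRing} (l : list X) (e : vexp) : X :=
  match e with
  | VZero => zero
  | VVar m => List.nth m l zero
  | VPlus e f => plus (vdenote l e) (vdenote l f)
  | VMinus e f => minus (vdenote l e) (vdenote l f)
  | VOpp e => opp (vdenote l e)
  | VScal k e => scal k (vdenote l e)
  end.

(** Normal form behind the tactic [vector]: [ring] and [field] act on scalars only, so an identity
    between vectors is reduced to equalities of real coefficients, one for each atom of the list. *)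
Fixpoint lincomb {X : NormedModule R_AbsRing} (c : nat -> R) (l : list X) : X :=
  match l with
  | nil => zero
  | cons x l => plus (scal (c O) x) (lincomb (fun n => c (Datatypes.S n)) l)
  end.

Lemma lincomb_ext {X : NormedModule R_AbsRing} (c d : nat -> R) (l : list X) :
  (forall n, c n = d n) -> lincomb c l = lincomb d l.
Proof.
  revert c d; induction l as [|x l IH]; intros c d H; simpl; [reflexivity|].
  rewrite H, (IH _ (fun n => d (Datatypes.S n))); auto.
Qed.

Lemma lincomb_zero {X : NormedModule R_AbsRing} (l : list X) :
  lincomb (fun _ => 0) l = zero.
Proof.
  induction l as [|x l IH]; simpl; [reflexivity|].
  rewrite IH, plus_zero_r. exact (scal_zero_l x).
Qed.

Lemma lincomb_plus {X : NormedModule R_AbsRing} (c d : nat -> R) (l : list X) :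
  lincomb (fun n => c n + d n) l = plus (lincomb c l) (lincomb d l).
Proof.
  revert c d; induction l as [|x l IH]; intros c d; simpl.
  - now rewrite plus_zero_r.
  - rewrite (IH (fun n => c (Datatypes.S n)) (fun n => d (Datatypes.S n))).
    replace (scal (c O + d O) x) with (plus (scal (c O) x) (scal (d O) x))
      by (symmetry; apply (scal_distr_r (c O) (d O) x)).
    rewrite <- !plus_assoc. f_equal.
    rewrite !plus_assoc. f_equal. apply plus_comm.
Qed.

Lemma lincomb_scal {X : NormedModule R_AbsRing} (k : R) (c : nat -> R) (l : list X) :
  lincomb (fun n => k * c n) l = scal k (lincomb c l).
Proof.
  revert c; induction l as [|x l IH]; intros c; simpl.
  - symmetry; exact (scal_zero_r (V := NormedModule.ModuleSpace R_AbsRing X) k).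
  - rewrite (IH (fun n => c (Datatypes.S n))), scal_distr_l. f_equal.
    symmetry; apply (scal_assoc k (c O) x).
Qed.

Lemma lincomb_var {X : NormedModule R_AbsRing} (m : nat) (l : list X) :
  lincomb (fun n => if Nat.eqb m n then 1 else 0) l = List.nth m l zero.
Proof.
  revert m; induction l as [|x l IH]; intros [|m]; simpl; try reflexivity.
  - rewrite lincomb_zero, plus_zero_r. exact (scal_one x).
  - rewrite IH. rewrite (scal_zero_l (K := R_Ring) x : scal 0 x = zero).
    apply plus_zero_l.
Qed.

Lemma opp_scal_neg1 {X : NormedModule R_AbsRing} (x : X) : opp x = scal (-1) x.
Proof. symmetry; exact (scal_opp_one (V := NormedModule.ModuleSpace R_AbsRing X) x). Qed.

Lemma vdenote_lincomb {X : NormedModule R_AbsRing} (l : list X) (e : vexp) :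
  vdenote l e = lincomb (vcoef e) l.
Proof.
  induction e as [|m|e IHe f IHf|e IHe f IHf|e IHe|k e IHe]; simpl.
  - symmetry; apply lincomb_zero.
  - symmetry; apply lincomb_var.
  - rewrite IHe, IHf; symmetry; apply lincomb_plus.
  - rewrite IHe, IHf; unfold minus.
    rewrite (opp_scal_neg1 (lincomb (vcoef f) l)).
    rewrite (lincomb_ext (fun n => vcoef e n - vcoef f n)
                         (fun n => vcoef e n + (-1) * vcoef f n)) by (intros; ring).
    rewrite lincomb_plus, lincomb_scal; reflexivity.
  - rewrite IHe, opp_scal_neg1.
    rewrite (lincomb_ext (fun n => - vcoef e n)
                         (fun n => (-1) * vcoef e n)) by (intros; ring).
    rewrite lincomb_scal; reflexivity.
  - rewrite IHe; symmetry; apply lincomb_scal.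
Qed.

Ltac vindex x l :=
  match l with
  | cons x _ => constr:(O)
  | cons _ ?l' => let n := vindex x l' in constr:(Datatypes.S n)
  end.

Ltac vatoms e l :=
  lazymatch e with
  | zero => l
  | plus ?a ?b => let l1 := vatoms a l in vatoms b l1
  | minus ?a ?b => let l1 := vatoms a l in vatoms b l1
  | opp ?a => vatoms a l
  | scal _ ?a => vatoms a l
  | _ => match l with
         | _ => let _ := vindex e l in l
         | _ => constr:(cons e l)
         end
  end.

Ltac vquote e l :=
  lazymatch e with
  | zero => constr:(VZero)
  | plus ?a ?b => let a' := vquote a l in let b' := vquote b l in constr:(VPlus a' b')
  | minus ?a ?b => let a' := vquote a l in let b' := vquote b l in constr:(VMinus a' b')
  | opp ?a => let a' := vquote a l in constr:(VOpp a')
  | scal ?k ?a => let a' := vquote a l in constr:(VScal k a')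
  | _ => let n := vindex e l in constr:(VVar n)
  end.

(* Proves an equation between linear combinations of vectors by comparing
   coefficients. *)
Ltac vector_with tac :=
  lazymatch goal with
  | |- @eq ?T ?a ?b =>
    let l1 := vatoms a (@nil T) in
    let l := vatoms b l1 in
    let ea := vquote a l in
    let eb := vquote b l in
    change (vdenote l ea = vdenote l eb);
    rewrite !vdenote_lincomb;
    cbv [lincomb vcoef Nat.eqb];
    repeat lazymatch goal with
    | |- plus (scal ?c ?x) _ = plus (scal ?d _) _ =>
      refine (f_equal2 plus (f_equal (fun k => scal k x) (_ : c = d)) _); [tac | ]
    end; reflexivity
  end.
Ltac vector := vector_with ltac:(ring).
Ltac vector_field := vector_with ltac:(field; auto).

Lemma le_of_le_plus_eps (x y : R) : (forall eps, 0 < eps -> x <= y + eps) -> x <= y.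
Proof. intros H. apply Rnot_lt_le; intros L. specialize (H ((x - y)/2)). lra. Qed.

Ltac rewrite_norm_with w tac :=
  match goal with |- norm ?u <= _ => replace u with w by tac end.
Ltac rewrite_norm w := rewrite_norm_with w ltac:(idtac; vector).

Section NormFacts.
Context {X : CompleteNormedModule R_AbsRing}.

Lemma norm_minus_trans (y x z : X) :
  norm (minus x z) <= norm (minus x y) + norm (minus y z).
Proof.
  replace (minus x z) with (plus (minus x y) (minus y z)) by vector.
  refine (norm_triangle _ _).
Qed.

Lemma norm_le_minus_plus (x y : X) : norm x <= norm (minus x y) + norm y.
Proof.
  replace x with (plus (minus x y) y) at 1 by vector.
  refine (norm_triangle _ _).
Qed.

Lemma norm_minus_le (x y : X) : norm (minus x y) <= norm x + norm y.
Proof.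
  replace (norm y) with (norm (opp y))
    by exact (norm_opp (V := CompleteNormedModule.NormedModule R_AbsRing X) y).
  unfold minus. refine (norm_triangle _ _).
Qed.

Lemma norm_minus_sym (x y : X) : norm (minus x y) = norm (minus y x).
Proof.
  transitivity (norm (opp (minus x y))); [symmetry|f_equal; vector].
  exact (norm_opp (V := CompleteNormedModule.NormedModule R_AbsRing X) _).
Qed.

Lemma norm_minus_diag (x : X) : norm (minus x x) = 0.
Proof.
  replace (minus x x) with (zero : X) by vector.
  exact (norm_zero (V := CompleteNormedModule.NormedModule R_AbsRing X)).
Qed.

Lemma norm_scal_le (k : R) (x : X) : norm (scal k x) <= Rabs k * norm x.
Proof. exact (norm_scal k x). Qed.

(** The derivative in multiplied-out form: without a quotient the point y = x needs no exclusion,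
    and the estimate can be added and chained directly. *)
Definition has_deriv_nonneg (f g : R -> X) : Prop :=
  forall x, 0 <= x -> forall eps, 0 < eps -> exists delta, 0 < delta /\
    forall y, 0 <= y -> Rabs (y - x) < delta ->
      norm (minus (minus (f y) (f x)) (scal (y - x) (g x))) <= eps * Rabs (y - x).

End NormFacts.

Lemma has_deriv_nonneg_of_deriv {X : CompleteNormedModule R_AbsRing} (f g : R -> X) :
  deriv_on_nonneg f g -> has_deriv_nonneg f g.
Proof.
  intros H x Hx eps Heps.
  specialize (H x Hx).
  destruct (proj1 (filterlim_locally_ball_norm _ _) H (mkposreal eps Heps)) as [d Hd].
  exists d. split; [apply cond_pos|].
  intros y Hy Hyd.
  destruct (Req_dec y x) as [->|Hne].
  - rewrite (Rminus_diag x : x - x = 0), Rabs_R0, Rmult_0_r.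
    rewrite_norm (zero : X).
    apply Req_le. exact (norm_zero (V := CompleteNormedModule.NormedModule R_AbsRing X)).
  - specialize (Hd y Hyd (conj Hy Hne)). unfold ball_norm in Hd. simpl in Hd.
    assert (Hyx : y - x <> 0) by lra.
    rewrite_norm_with (scal (y - x) (minus (scal (/ (y - x)) (minus (f y) (f x))) (g x)))
      ltac:(idtac; vector_field).
    eapply Rle_trans; [refine (norm_scal_le _ _)|].
    rewrite Rmult_comm. apply Rmult_le_compat_r; [apply Rabs_pos | exact (Rlt_le _ _ Hd)].
Qed.

(** * Mean value inequality, Taylor remainder and interpolation error *)

Section MeanValue.
Context {X : CompleteNormedModule R_AbsRing}.

(** A vector-valued function has no mean value equality, so the slope K + eps is propagated from x:
    let c be the supremum of the points where the bound with this slope holds. The local estimate at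
    c carries the bound from points just left of c to c, and, if c < y, from c to a point beyond it,
    which is absurd. *)
Lemma mean_value_le (f g : R -> X) (K x y : R) :
  has_deriv_nonneg f g -> 0 <= x <= y ->
  (forall z, x <= z <= y -> norm (g z) <= K) ->
  norm (minus (f y) (f x)) <= K * (y - x).
Proof.
  intros Hf Hxy HK.
  assert (Hloc : forall eps c, 0 < eps -> x <= c <= y -> exists delta, 0 < delta /\
    forall s, 0 <= s -> Rabs (s - c) < delta ->
      norm (minus (f s) (f c)) <= (K + eps) * Rabs (s - c)).
  { intros eps c He Hc.
    destruct (Hf c ltac:(lra) eps He) as [d [Hd Hd']].
    exists d; split; auto. intros s Hs Hsd.
    eapply Rle_trans; [refine (norm_le_minus_plus _ (scal (s - c) (g c)))|].
    specialize (Hd' s Hs Hsd).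
    pose proof (norm_scal_le (s - c) (g c)) as H1.
    pose proof (HK c Hc). pose proof (Rabs_pos (s - c)). nra. }
  apply le_of_le_plus_eps. intros eps0 Heps0.
  set (eps := eps0 / (1 + (y - x))).
  assert (Heps : 0 < eps) by (apply Rdiv_lt_0_compat; lra).
  assert (Heps1 : eps * (y - x) <= eps0).
  { unfold eps. apply (Rmult_le_reg_r (1 + (y - x))); [lra|]. field_simplify; nra. }
  set (E := fun s => x <= s <= y /\ norm (minus (f s) (f x)) <= (K + eps) * (s - x)).
  assert (Ex : E x).
  { split; [lra|]. rewrite norm_minus_diag. lra. }
  destruct (completeness E) as [c [Hub Hlub]].
  - exists y. intros s [Hs _]; lra.
  - now exists x.
  - assert (Hxc : x <= c) by now apply Hub.
    assert (Hcy : c <= y) by (apply Hlub; intros s [Hs _]; lra).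
    destruct (Hloc eps c Heps (conj Hxc Hcy)) as [d [Hd Hd']].
    assert (Ec : E c).
    { split; [lra|].
      destruct (Classical_Prop.classic (exists s, E s /\ c - d < s)) as [[s [Es Hs]]|Hn].
      - assert (s <= c) by now apply Hub.
        destruct Es as [Hs1 Hs2].
        specialize (Hd' s ltac:(lra) ltac:(rewrite Rabs_left1; lra)).
        rewrite Rabs_left1 in Hd' by lra.
        eapply Rle_trans; [apply (norm_minus_trans (f s))|].
        rewrite (norm_minus_sym (f c)). nra.
      - exfalso. assert (c <= c - d); [|lra].
        apply Hlub. intros s Es. apply Rnot_lt_le. intros L. apply Hn. now exists s. }
    assert (c = y).
    { destruct (Req_dec c y) as [|Hne]; auto. exfalso.
      set (s := Rmin y (c + d / 2)).
      assert (Hs : c < s <= y /\ s <= c + d / 2).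
      { unfold s. split; [split; [apply Rmin_glb_lt; lra | apply Rmin_l] | apply Rmin_r]. }
      assert (Es : E s).
      { split; [lra|].
        specialize (Hd' s ltac:(lra) ltac:(rewrite Rabs_right; lra)).
        rewrite Rabs_right in Hd' by lra.
        eapply Rle_trans; [apply (norm_minus_trans (f c))|].
        destruct Ec as [_ Ec]. nra. }
      specialize (Hub s Es). lra. }
    subst c. destruct Ec as [_ Ec]. nra.
Qed.

Lemma mean_value_le_abs (f g : R -> X) (K a x : R) :
  has_deriv_nonneg f g -> 0 <= a -> 0 <= x ->
  (forall z, 0 <= z -> Rabs (z - a) <= Rabs (x - a) -> norm (g z) <= K) ->
  norm (minus (f x) (f a)) <= K * Rabs (x - a).
Proof.
  intros Hf Ha Hx HK.
  destruct (Rle_dec a x) as [L|L].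
  - rewrite (Rabs_right (x - a)) in * by lra.
    apply (mean_value_le f g); auto; try lra.
    intros z Hz. apply HK; [lra|]. rewrite Rabs_right; lra.
  - rewrite (Rabs_left1 (x - a)) in * by lra.
    rewrite norm_minus_sym. replace (- (x - a)) with (a - x) by ring.
    apply (mean_value_le f g); auto; try lra.
    intros z Hz. apply HK; [lra|]. rewrite Rabs_left1; lra.
Qed.

(** The hypothesis on p is its exact second-order expansion, so p is a polynomial of degree at most
    2 with derivative q and leading coefficient k. Subtracting such polynomials one after the other
    builds Taylor remainders. *)
Lemma has_deriv_nonneg_sub_quadratic (f g : R -> X) (p q : R -> R) (k : R) (v : X) :
  (forall x y, p y - p x = q x * (y - x) + k * (y - x) ^ 2) ->
  has_deriv_nonneg f g ->
  has_deriv_nonneg (fun x => minus (f x) (scal (p x) v)) (fun x => minus (g x) (scal (q x) v)).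
Proof.
  intros Hpq Hf x Hx eps Heps.
  destruct (Hf x Hx (eps / 2) ltac:(lra)) as [d [Hd Hd']].
  set (B := Rabs k * norm v).
  assert (HB : 0 <= B) by (apply Rmult_le_pos; [apply Rabs_pos | apply norm_ge_0]).
  exists (Rmin d (eps / 2 / (1 + B))).
  assert (He : 0 < eps / 2 / (1 + B)) by (apply Rdiv_lt_0_compat; lra).
  split; [now apply Rmin_glb_lt|].
  intros y Hy Hyd.
  assert (H1 : Rabs (y - x) < d) by (eapply Rlt_le_trans; [apply Hyd | apply Rmin_l]).
  assert (H2 : Rabs (y - x) * (1 + B) < eps / 2).
  { apply (Rmult_lt_reg_r (/ (1 + B))); [apply Rinv_0_lt_compat; lra|].
    rewrite Rmult_assoc, Rinv_r, Rmult_1_r by lra.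
    eapply Rlt_le_trans; [apply Hyd | apply Rmin_r]. }
  match goal with |- norm ?u <= _ => replace u with
    (minus (minus (minus (f y) (f x)) (scal (y - x) (g x))) (scal (k * (y - x) ^ 2) v)) end.
  2:{ replace (k * (y - x) ^ 2) with (p y - p x - q x * (y - x)) by (rewrite Hpq; ring).
      vector. }
  eapply Rle_trans; [refine (norm_minus_le _ _)|].
  specialize (Hd' y Hy H1).
  pose proof (norm_scal_le (k * (y - x) ^ 2) v) as H3.
  rewrite Rabs_mult, <- RPow_abs in H3.
  pose proof (Rabs_pos (y - x)).
  replace (Rabs k * Rabs (y - x) ^ 2 * norm v) with (Rabs (y - x) * (Rabs (y - x) * B)) in H3
    by (unfold B; ring).
  nra.
Qed.

(** The mean value inequality is applied successively to h'', to h' minus its linear part and to h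
    minus its quadratic part. Each time the derivative is bounded by its worst value on the
    interval, which yields M instead of M/6. *)
Lemma taylor2_remainder (h h1 h2 h3 : R -> X) (M a x : R) :
  has_deriv_nonneg h h1 -> has_deriv_nonneg h1 h2 -> has_deriv_nonneg h2 h3 ->
  (forall z, 0 <= z -> norm (h3 z) <= M) -> 0 <= a -> 0 <= x ->
  norm (minus (minus (minus (h x) (scal (/ 2 * (x - a) ^ 2) (h2 a))) (scal (x - a) (h1 a))) (h a))
    <= M * Rabs (x - a) ^ 3.
Proof.
  intros D1 D2 D3 HM Ha Hx.
  assert (M0 : 0 <= M) by (apply Rle_trans with (norm (h3 0)); [apply norm_ge_0 | apply HM; lra]).
  assert (T1 : forall z, 0 <= z -> norm (minus (h2 z) (h2 a)) <= M * Rabs (z - a)).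
  { intros z Hz. apply (mean_value_le_abs h2 h3); auto. }
  assert (T2 : forall z, 0 <= z ->
    norm (minus (minus (h1 z) (scal (z - a) (h2 a))) (h1 a)) <= M * Rabs (z - a) ^ 2).
  { intros z Hz.
    pose proof (has_deriv_nonneg_sub_quadratic h1 h2 (fun z => z - a) (fun _ => 1) 0 (h2 a)
                  ltac:(intros; simpl; ring) D2) as D.
    pose proof (mean_value_le_abs _ _ (M * Rabs (z - a)) a z D Ha Hz) as H.
    cbv beta in H. match type of H with _ -> norm ?u <= _ =>
      replace (minus (minus (h1 z) (scal (z - a) (h2 a))) (h1 a)) with u by vector end.
    replace (M * Rabs (z - a) ^ 2) with (M * Rabs (z - a) * Rabs (z - a)) by ring.
    apply H. intros w Hw Hwz.
    replace (minus (h2 w) (scal 1 (h2 a))) with (minus (h2 w) (h2 a)) by vector.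
    eapply Rle_trans; [apply (T1 w Hw)|]. now apply Rmult_le_compat_l. }
  pose proof (has_deriv_nonneg_sub_quadratic h h1 (fun z => / 2 * (z - a) ^ 2)
                (fun z => z - a) (/ 2) (h2 a) ltac:(intros; simpl; field) D1) as D.
  apply (has_deriv_nonneg_sub_quadratic _ _ (fun z => z - a) (fun _ => 1) 0 (h1 a)
           ltac:(intros; simpl; ring)) in D.
  pose proof (mean_value_le_abs _ _ (M * Rabs (x - a) ^ 2) a x D Ha Hx) as H.
  cbv beta in H. match type of H with _ -> norm ?u <= _ =>
      match goal with |- norm ?w <= _ => replace w with u by vector end end.
  replace (M * Rabs (x - a) ^ 3) with (M * Rabs (x - a) ^ 2 * Rabs (x - a)) by ring.
  apply H. intros z Hz Hza.
  match goal with |- norm ?u <= _ =>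
    replace u with (minus (minus (h1 z) (scal (z - a) (h2 a))) (h1 a)) by vector end.
  eapply Rle_trans; [apply (T2 z Hz)|]. apply Rmult_le_compat_l; auto.
  apply pow_incr; split; [apply Rabs_pos | auto].
Qed.

(** Expand h(x) and h(p2) at p1. The linear terms cancel, and the quadratic ones combine by (x -
    p1)^2 - (x - p1) (p2 - p1) = (x - p1) (x - p2). The remainder at p2 carries the factor (x - p1)
    / (p2 - p1), which is harmless however close the nodes are, because that remainder is cubic in
    p2 - p1. The point x may lie outside the nodes. *)
Lemma linear_interpolation_error (h h1 h2 h3 : R -> X) (M x p1 p2 D : R) :
  has_deriv_nonneg h h1 -> has_deriv_nonneg h1 h2 -> has_deriv_nonneg h2 h3 ->
  (forall z, 0 <= z -> norm (h3 z) <= M) -> 0 <= x -> 0 <= p1 -> 0 <= p2 -> p1 <> p2 ->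
  Rabs (x - p1) <= D -> Rabs (p2 - p1) <= D ->
  let al := scal (/ (p2 - p1)) (minus (h p2) (h p1)) in
  norm (minus (minus (h x) (plus (minus (h p1) (scal p1 al)) (scal x al)))
              (scal (/ 2 * ((x - p1) * (x - p2))) (h2 p1))) <= 2 * M * D ^ 3.
Proof.
  intros D1 D2 D3 HM Hx H1 H2 Hne Hx1 H21 al.
  assert (M0 : 0 <= M) by (apply Rle_trans with (norm (h3 0)); [apply norm_ge_0 | apply HM; lra]).
  pose proof (taylor2_remainder h h1 h2 h3 M p1 x D1 D2 D3 HM H1 Hx) as Tx.
  pose proof (taylor2_remainder h h1 h2 h3 M p1 p2 D1 D2 D3 HM H1 H2) as T2.
  match type of Tx with norm ?u <= _ => set (Rx := u) in Tx end.
  match type of T2 with norm ?u <= _ => set (R2 := u) in T2 end.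
  assert (Hd : p2 - p1 <> 0) by lra.
  match goal with |- norm ?u <= _ =>
    replace u with (minus Rx (scal ((x - p1) / (p2 - p1)) R2)) by
      (unfold Rx, R2, al; vector_field) end.
  eapply Rle_trans; [refine (norm_minus_le _ _)|].
  pose proof (norm_scal_le ((x - p1) / (p2 - p1)) R2) as H3.
  assert (Ha : Rabs (p2 - p1) <> 0) by now apply Rabs_no_R0.
  assert (H4 : Rabs ((x - p1) / (p2 - p1)) * norm R2 <= M * D ^ 3).
  { unfold Rdiv. rewrite Rabs_mult, Rabs_inv.
    apply Rle_trans with (Rabs (x - p1) * / Rabs (p2 - p1) * (M * Rabs (p2 - p1) ^ 3)).
    - apply Rmult_le_compat_l; auto. apply Rmult_le_pos; [apply Rabs_pos|].
      apply Rlt_le, Rinv_0_lt_compat, Rabs_pos_lt; auto.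
    - replace (_ * _ * _) with (M * (Rabs (x - p1) * Rabs (p2 - p1) ^ 2)) by (field; auto).
      apply Rmult_le_compat_l; auto. replace (D ^ 3) with (D * D ^ 2) by ring.
      apply Rmult_le_compat; auto using Rabs_pos, pow2_ge_0.
      apply pow_incr; split; auto using Rabs_pos. }
  assert (H5 : M * Rabs (x - p1) ^ 3 <= M * D ^ 3).
  { apply Rmult_le_compat_l; auto. apply pow_incr; split; auto using Rabs_pos. }
  lra.
Qed.

End MeanValue.

(** * Strongly continuous semigroups *)

Section Semigroups.
Context {X : CompleteNormedModule R_AbsRing}.
Context (S : R -> X -> X) (HS : C0_semigroup S).

Lemma semigroup_linear t : 0 <= t -> is_linear (S t).
Proof.
  destruct HS as (Hp & Hs & Hb & _). intros Ht. split.
  - intros x y. now apply Hp.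
  - intros k x. now apply Hs.
  - destruct (Hb t Ht) as [M HM]. exists (Rmax M 1). split.
    + eapply Rlt_le_trans; [|apply Rmax_r]; lra.
    + intros x. eapply Rle_trans; [apply HM|].
      apply Rmult_le_compat_r; [apply norm_ge_0 | apply Rmax_l].
Qed.

Lemma semigroup_minus t x y : 0 <= t -> S t (minus x y) = minus (S t x) (S t y).
Proof.
  destruct HS as (Hp & Hs & _). intros Ht.
  replace (minus x y) with (plus x (scal (-1) y)) by vector.
  rewrite (Hp t Ht), (Hs t Ht). vector.
Qed.

Lemma semigroup_right_cont0 x eps : 0 < eps ->
  exists d, 0 < d /\ forall u, 0 <= u < d -> norm (minus (S u x) x) < eps.
Proof.
  intros He. destruct HS as (_ & _ & _ & H0 & _ & Hc).
  destruct (proj1 (filterlim_locally_ball_norm _ _) (Hc x) (mkposreal eps He)) as [d Hd].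
  exists d. split; [apply cond_pos|]. intros u [Hu1 Hu2].
  destruct (Req_dec u 0) as [->|Hne].
  - rewrite H0. eapply Rle_lt_trans; [|exact He].
    apply Req_le. exact (norm_minus_diag _).
  - apply (Hd u); [|lra].
    change (Rabs (u - 0) < d). rewrite Rminus_0_r, Rabs_right; lra.
Qed.

(* A failure of the conclusion yields nested balls on the n-th of which some S t, t <= 1/(n+1),
   has norm at least n; at their common point this contradicts S t x -> x. *)
Lemma semigroup_bounded_on_ball : exists (n : nat) (c : X) (rho : R), 0 < rho /\
  forall t (x : X), 0 <= t <= / INR (n + 1) -> norm (minus x c) < rho -> norm (S t x) <= INR n.
Proof.
  apply NNPP. intros Hno.
  assert (Hstep : forall (n : nat) (b : X * posreal), exists b' : X * posreal,
    (snd b') <= / INR (n + 1) /\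
    forall x, norm (minus x (fst b')) <= (snd b') -> norm (minus x (fst b)) <= (snd b) /\
      exists t, 0 <= t <= / INR (n + 1) /\ INR n <= norm (S t x)).
  { intros n [c [rho Hrho]]. simpl.
    apply NNPP. intros Hn. apply Hno. exists n, c, rho. split; auto.
    intros t x Ht Hx. apply Rnot_lt_le. intros HL. apply Hn.
    destruct (linear_norm _ (semigroup_linear t (proj1 Ht))) as [L [HL0 HL1]].
    assert (Hin : 0 < / INR (n + 1)).
    { apply Rinv_0_lt_compat, lt_0_INR. lia. }
    assert (Hq : 0 < (norm (S t x) - INR n) / L) by (apply Rdiv_lt_0_compat; lra).
    (* The three bounds make the centres a Cauchy sequence, keep the new ball inside the old one,
       and keep the norm of [S t y] at least n on the whole new ball, L being a bound for [S t]. *)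
    set (r := Rmin (/ INR (n + 1)) (Rmin (rho - norm (minus x c)) ((norm (S t x) - INR n) / L))).
    assert (Hr : 0 < r) by (repeat apply Rmin_glb_lt; lra).
    assert (Hr1 : r <= / INR (n + 1)) by apply Rmin_l.
    assert (Hr2 : r <= rho - norm (minus x c)).
    { eapply Rle_trans; [apply Rmin_r | apply Rmin_l]. }
    assert (Hr3 : L * r <= norm (S t x) - INR n).
    { apply Rle_trans with (L * ((norm (S t x) - INR n) / L)).
      - apply Rmult_le_compat_l; [lra|]. eapply Rle_trans; [apply Rmin_r | apply Rmin_r].
      - apply Req_le. field. lra. }
    exists (x, mkposreal r Hr). simpl. split; auto.
    intros y Hy. split.
    - pose proof (norm_minus_trans x y c). lra.
    - exists t. split; auto.
      assert (H1 : norm (minus (S t y) (S t x)) <= L * norm (minus y x)).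
      { rewrite <- (semigroup_minus t y x) by tauto. apply HL1. }
      assert (H2 : norm (S t x) <= norm (minus (S t x) (S t y)) + norm (S t y))
        by refine (norm_le_minus_plus _ _).
      rewrite norm_minus_sym in H2. nra. }
  set (next := fun n b => proj1_sig (constructive_indefinite_description _ (Hstep n b))).
  assert (Hnext : forall n b, (snd (next n b)) <= / INR (n + 1) /\
    forall x, norm (minus x (fst (next n b))) <= (snd (next n b)) -> norm (minus x (fst b)) <= (snd b) /\
      exists t, 0 <= t <= / INR (n + 1) /\ INR n <= norm (S t x)).
  { intros n b. exact (proj2_sig (constructive_indefinite_description _ (Hstep n b))). }
  set (b := fix b n := match n with
    | O => (zero : X, mkposreal 1 Rlt_0_1) | Datatypes.S m => next m (b m) end).
  assert (Hnest : forall k n x, norm (minus x (fst (b (n + k)%nat))) <= (snd (b (n + k)%nat)) ->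
                           norm (minus x (fst (b n))) <= (snd (b n))).
  { induction k as [|k IH]; intros n x H.
    - now rewrite Nat.add_0_r in H.
    - apply IH. rewrite Nat.add_succ_r in H.
      exact (proj1 (proj2 (Hnext (n + k)%nat (b (n + k)%nat)) x H)). }
  assert (Hself : forall n, norm (minus (fst (b n)) (fst (b n))) <= (snd (b n))).
  { intros n. rewrite norm_minus_diag.
    apply Rlt_le, cond_pos. }
  assert (Hdist : forall n m, (n <= m)%nat -> norm (minus (fst (b m)) (fst (b n))) <= (snd (b n))).
  { intros n m Hnm. apply (Hnest (m - n)%nat).
    replace (n + (m - n))%nat with m by lia. apply Hself. }
  destruct (proj1 (filterlim_locally_cauchy (F := eventually) (fun n => (fst (b n))))) as [x Hx].
  { intros eps.
    set (nf := norm_factor (V := CompleteNormedModule.NormedModule R_AbsRing X)).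
    destruct (archimed_cor1 (eps / 2)) as [N [HN1 HN2]].
    { pose proof (cond_pos eps). lra. }
    exists (fun n => (N <= n)%nat). split; [now exists N|].
    intros u v Hu Hv.
    apply (norm_compat1 (V := CompleteNormedModule.NormedModule R_AbsRing X)).
    assert (H1 : forall w, (N <= w)%nat -> norm (minus (fst (b w)) (fst (b N))) < eps / 2).
    { intros w Hw. eapply Rle_lt_trans; [|exact HN1].
      eapply Rle_trans; [now apply Hdist|].
      destruct N as [|N]; [lia|].
      replace (INR (Datatypes.S N)) with (INR (N + 1)) by (f_equal; lia).
      apply (proj1 (Hnext N (b N))). }
    pose proof (norm_minus_trans (fst (b N)) (fst (b v)) (fst (b u))) as H2.
    rewrite (norm_minus_sym (fst (b N))) in H2.
    pose proof (H1 u Hu). pose proof (H1 v Hv).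
    eapply Rle_lt_trans; [exact H2|]. lra. }
  assert (Hxb : forall n, norm (minus x (fst (b n))) <= (snd (b n))).
  { intros n. apply le_of_le_plus_eps. intros eps He.
    destruct (proj1 (filterlim_locally_ball_norm _ _) Hx (mkposreal eps He)) as [N HN].
    specialize (HN (Nat.max N n) (Nat.le_max_l _ _)).
    specialize (Hdist n (Nat.max N n) (Nat.le_max_r _ _)).
    change (norm (minus (fst (b (Nat.max N n))) x) < eps) in HN.
    rewrite norm_minus_sym in HN.
    eapply Rle_trans; [apply (norm_minus_trans (fst (b (Nat.max N n))))|]. lra. }
  destruct (semigroup_right_cont0 x 1 Rlt_0_1) as [d [Hd Hd']].
  destruct (archimed_cor1 d Hd) as [N1 [HN1 HN1']].
  destruct (INR_unbounded (norm x + 1)) as [N2 HN2].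
  set (n := Nat.max N1 N2).
  (* Ball n + 1 is [next n (b n)], so membership in it provides the bad time for index n. Since n >=
     N1, this time is below d, where [S t x] is within 1 of x; since n >= N2, n exceeds norm x +
     1. *)
  destruct (proj2 (proj2 (Hnext n (b n)) x (Hxb (Datatypes.S n)))) as [t [Ht1 Ht2]].
  assert (Hnd : / INR (n + 1) < d).
  { eapply Rle_lt_trans; [|exact HN1]. apply Rinv_le_contravar; [now apply lt_0_INR|].
    apply le_INR. lia. }
  specialize (Hd' t ltac:(lra)).
  assert (H1 : norm (S t x) <= norm (minus (S t x) x) + norm x)
    by refine (norm_le_minus_plus _ _).
  assert (INR N2 <= INR n) by (apply le_INR; lia).
  lra.
Qed.

(** Subtracting the value at the centre of the ball gives the bound 2n for vectors shorter than rho;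
    rescaling x to length rho/2 turns it into the factor 4n/rho. *)
Lemma semigroup_bounded_near_0 : exists d M, 0 < d /\ 1 <= M /\
  forall t (x : X), 0 <= t <= d -> norm (S t x) <= M * norm x.
Proof.
  destruct semigroup_bounded_on_ball as (n & c & rho & Hrho & H).
  assert (Hn0 : 0 <= INR n) by apply pos_INR.
  exists (/ INR (n + 1)), (Rmax 1 (4 * INR n / rho)).
  assert (Hin : 0 < / INR (n + 1)).
  { apply Rinv_0_lt_compat, lt_0_INR. lia. }
  split; [auto|]. split; [apply Rmax_l|].
  intros t x Ht.
  destruct HS as (Hp & Hs & _).
  assert (Hc : norm (S t c) <= INR n).
  { apply H; auto. rewrite norm_minus_diag. exact Hrho. }
  assert (Hsmall : forall z, norm z < rho -> norm (S t z) <= 2 * INR n).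
  { intros z Hz.
    assert (H1 : norm (S t (plus z c)) <= INR n).
    { apply H; auto. match goal with |- norm ?u < _ => replace u with z by vector end. exact Hz. }
    replace (S t z) with (minus (S t (plus z c)) (S t c)).
    - eapply Rle_trans; [refine (norm_minus_le _ _)|]. lra.
    - rewrite <- semigroup_minus by tauto. f_equal. vector. }
  destruct (Rle_lt_or_eq_dec 0 (norm x) (norm_ge_0 x)) as [Hx|Hx].
  - assert (H1 : norm (scal (rho / (2 * norm x)) x) < rho).
    { eapply Rle_lt_trans; [refine (norm_scal_le _ _)|].
      rewrite Rabs_right by (apply Rle_ge, Rlt_le, Rdiv_lt_0_compat; lra).
      replace (rho / (2 * norm x) * norm x) with (rho / 2) by (field; lra). lra. }
    specialize (Hsmall _ H1).
    replace (S t x) with (scal (2 * norm x / rho) (S t (scal (rho / (2 * norm x)) x))).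
    + eapply Rle_trans; [refine (norm_scal_le _ _)|].
      rewrite Rabs_right by (apply Rle_ge, Rlt_le, Rdiv_lt_0_compat; lra).
      apply Rle_trans with (4 * INR n / rho * norm x).
      * apply Rle_trans with (2 * norm x / rho * (2 * INR n)).
        -- apply Rmult_le_compat_l; auto. apply Rlt_le, Rdiv_lt_0_compat; lra.
        -- apply Req_le. field. lra.
      * apply Rmult_le_compat_r; [apply norm_ge_0 | apply Rmax_r].
    + rewrite (Hs t) by tauto.
      set (y := S t x). assert (rho <> 0) by lra. assert (norm x <> 0) by lra. vector_field.
  - symmetry in Hx. pose proof (norm_eq_zero x Hx) as ->.
    destruct (linear_norm _ (semigroup_linear t (proj1 Ht))) as [L [_ HL]].
    specialize (HL zero). rewrite Hx in *. lra.
Qed.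

(** The interval is covered by steps of length d, and the semigroup law multiplies the bound by M at
    each of them. *)
Lemma semigroup_bounded T : exists M, 1 <= M /\
  forall t (x : X), 0 <= t <= T -> norm (S t x) <= M * norm x.
Proof.
  destruct semigroup_bounded_near_0 as (d & M & Hd & HM & H).
  assert (Hn : forall n, exists M', 1 <= M' /\
    forall t (x : X), 0 <= t <= INR n * d -> norm (S t x) <= M' * norm x).
  { induction n as [|n [M' [HM' IH]]].
    - exists 1. split; [lra|]. intros t x Ht. simpl in Ht.
      replace t with 0 by lra. destruct HS as (_ & _ & _ & H0 & _). rewrite H0. lra.
    - exists (M * M'). split; [nra|]. intros t x Ht. rewrite S_INR in Ht.
      destruct (Rle_dec t d) as [L|L].
      + eapply Rle_trans; [apply H; lra|].
        apply Rmult_le_compat_r; [apply norm_ge_0 | nra].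
      + destruct HS as (_ & _ & _ & _ & Ha & _).
        replace t with (d + (t - d)) by ring. rewrite Ha by lra.
        eapply Rle_trans; [apply H; lra|]. rewrite Rmult_assoc.
        apply Rmult_le_compat_l; [lra|]. apply IH. lra. }
  destruct (INR_unbounded (T / d)) as [n HnT].
  destruct (Hn n) as [M' [HM' H']]. exists M'. split; auto.
  intros t x Ht. apply H'. split; [tauto|].
  apply Rle_trans with (T / d * d); [field_simplify; lra|].
  apply Rmult_le_compat_r; lra.
Qed.

(** For s <= t the factor [S s] is pulled out of the difference, so continuity in time at any point
    is reduced to right continuity at 0. *)
Lemma semigroup_diff_le T M :
  (forall t (x : X), 0 <= t <= T -> norm (S t x) <= M * norm x) ->
  forall s t x, 0 <= s <= T -> 0 <= t <= T ->
  norm (minus (S t x) (S s x)) <= M * norm (minus (S (Rabs (t - s)) x) x).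
Proof.
  intros HM.
  assert (Hle : forall s t x, 0 <= s <= t -> t <= T ->
    norm (minus (S t x) (S s x)) <= M * norm (minus (S (t - s) x) x)).
  { intros s t x Hst HtT. destruct HS as (_ & _ & _ & _ & Ha & _).
    replace t with (s + (t - s)) at 1 by ring. rewrite Ha by lra.
    rewrite <- semigroup_minus by tauto. apply HM. lra. }
  intros s t x Hs Ht. destruct (Rle_dec s t).
  - rewrite Rabs_right by lra. apply Hle; lra.
  - rewrite Rabs_left by lra. rewrite (norm_minus_sym (S t x)).
    replace (- (t - s)) with (s - t) by ring. apply Hle; lra.
Qed.

(** Continuity here is two-sided, while nothing is known about [S] at negative times; truncating the
    time by [Rmax 0] gives an everywhere continuous integrand that agrees with the true one where
    the time is nonnegative. *)
Lemma semigroup_apply_continuous (f : R -> X) (p : R -> R) s :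
  continuous p s -> continuous f s -> continuous (fun s => S (Rmax 0 (p s)) (f s)) s.
Proof.
  intros Hp Hf.
  refine (proj2 (filterlim_locally_ball_norm (K := R_AbsRing)
    (U := CompleteNormedModule.NormedModule R_AbsRing X) _ _) _).
  intros [eps He].
  destruct (semigroup_bounded (Rabs (p s) + 1)) as (M & HM & HB).
  destruct (semigroup_right_cont0 (f s) (eps / 2 / M)) as [d [Hd Hd']].
  { apply Rdiv_lt_0_compat; lra. }
  assert (Hr : 0 < Rmin d 1) by (apply Rmin_glb_lt; lra).
  assert (He2 : 0 < eps / 2 / M) by (apply Rdiv_lt_0_compat; lra).
  pose proof (proj1 (filterlim_locally_ball_norm _ _) Hp (mkposreal _ Hr)) as Np.
  pose proof (proj1 (filterlim_locally_ball_norm _ _) Hf (mkposreal _ He2)) as Nf.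
  generalize (filter_and _ _ Np Nf). apply filter_imp.
  intros u [Hu1 Hu2].
  change (Rabs (p u - p s) < Rmin d 1) in Hu1.
  change (norm (minus (f u) (f s)) < eps / 2 / M) in Hu2.
  change (norm (minus (S (Rmax 0 (p u)) (f u)) (S (Rmax 0 (p s)) (f s))) < eps).
  assert (Hd1 : Rabs (p u - p s) < d) by (eapply Rlt_le_trans; [exact Hu1 | apply Rmin_l]).
  assert (Hd2 : Rabs (p u - p s) < 1) by (eapply Rlt_le_trans; [exact Hu1 | apply Rmin_r]).
  assert (Hmax : forall a, 0 <= Rmax 0 a) by (intros; apply Rmax_l).
  assert (Hmu : Rmax 0 (p u) <= Rabs (p s) + 1).
  { apply Rmax_lub; [pose proof (Rabs_pos (p s)); lra|].
    pose proof (Rle_abs (p s)). pose proof (Rle_abs (p u - p s)). lra. }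
  assert (Hms : Rmax 0 (p s) <= Rabs (p s) + 1).
  { apply Rmax_lub; [pose proof (Rabs_pos (p s)); lra|]. pose proof (Rle_abs (p s)). lra. }
  assert (Hlip : Rabs (Rmax 0 (p u) - Rmax 0 (p s)) <= Rabs (p u - p s)).
  { unfold Rmax; destruct (Rle_dec 0 (p u)), (Rle_dec 0 (p s));
      unfold Rabs; repeat destruct Rcase_abs; lra. }
  eapply Rle_lt_trans; [apply (norm_minus_trans (S (Rmax 0 (p u)) (f s)))|].
  rewrite <- semigroup_minus by auto.
  assert (H1 : norm (S (Rmax 0 (p u)) (minus (f u) (f s))) <= M * norm (minus (f u) (f s)))
    by (apply HB; auto).
  assert (H2 : M * norm (minus (f u) (f s)) < eps / 2).
  { apply Rlt_le_trans with (M * (eps / 2 / M)); [apply Rmult_lt_compat_l; lra|].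
    apply Req_le. field. lra. }
  pose proof (semigroup_diff_le _ M HB (Rmax 0 (p s)) (Rmax 0 (p u)) (f s)
                (conj (Hmax _) Hms) (conj (Hmax _) Hmu)) as H3.
  specialize (Hd' (Rabs (Rmax 0 (p u) - Rmax 0 (p s))) ltac:(split; [apply Rabs_pos | lra])).
  assert (H4 : M * norm (minus (S (Rabs (Rmax 0 (p u) - Rmax 0 (p s))) (f s)) (f s)) < eps / 2).
  { apply Rlt_le_trans with (M * (eps / 2 / M)); [apply Rmult_lt_compat_l; lra|].
    apply Req_le. field. lra. }
  lra.
Qed.

(* Telescoping over a subdivision of [0, t] into m equal steps replaces the fundamental
   theorem of calculus for S t v. *)
Lemma semigroup_generator_le T M v w :
  (forall t (x : X), 0 <= t <= T -> norm (S t x) <= M * norm x) -> 0 <= M ->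
  gen_graph S v w ->
  forall t, 0 <= t <= T -> norm (minus (S t v) v) <= M * t * norm w.
Proof.
  intros HM M0 Hvw t Ht.
  destruct HS as (_ & _ & _ & H0 & Ha & _).
  destruct (Req_dec t 0) as [->|Hne].
  { rewrite H0. rewrite norm_minus_diag. lra. }
  assert (Htel : forall u m, 0 <= u -> INR m * u <= T ->
    norm (minus (S (INR m * u) v) v) <= INR m * (M * norm (minus (S u v) v))).
  { intros u m Hu. induction m as [|m IH]; intros Hm.
    - simpl. rewrite Rmult_0_l, H0. rewrite norm_minus_diag. lra.
    - rewrite S_INR in *. pose proof (pos_INR m).
      assert (Hmu : 0 <= INR m * u) by nra.
      replace ((INR m + 1) * u) with (INR m * u + u) by ring.
      rewrite Ha by auto.
      eapply Rle_trans; [apply (norm_minus_trans (S (INR m * u) v))|].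
      rewrite <- semigroup_minus by auto.
      assert (H1 : norm (S (INR m * u) (minus (S u v) v)) <= M * norm (minus (S u v) v))
        by (apply HM; nra).
      specialize (IH ltac:(nra)). lra. }
  apply le_of_le_plus_eps. intros eps He.
  assert (He' : 0 < eps / (1 + M * t)) by (apply Rdiv_lt_0_compat; nra).
  destruct (proj1 (filterlim_locally_ball_norm _ _) Hvw (mkposreal _ He')) as [d Hd].
  destruct (archimed_cor1 (d / t)) as [m [Hm1 Hm2]].
  { apply Rdiv_lt_0_compat; [apply cond_pos | lra]. }
  assert (Hm0 : 0 < INR m) by now apply lt_0_INR.
  set (u := t / INR m).
  assert (Hu : 0 < u) by (apply Rdiv_lt_0_compat; lra).
  assert (Hut : INR m * u = t) by (unfold u; field; lra).
  assert (Hud : u < d).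
  { unfold u, Rdiv. apply (Rmult_lt_reg_r (/ t)); [apply Rinv_0_lt_compat; lra|].
    replace (t * / INR m * / t) with (/ INR m) by (field; lra). exact Hm1. }
  specialize (Htel u m (Rlt_le _ _ Hu) ltac:(lra)). rewrite Hut in Htel.
  assert (H1 : norm (minus (scal (/ u) (minus (S u v) v)) w) < eps / (1 + M * t)).
  { apply (Hd u); auto. change (Rabs (u - 0) < d). rewrite Rminus_0_r, Rabs_right; lra. }
  assert (H2 : norm (minus (S u v) v) <= u * (norm w + eps / (1 + M * t))).
  { assert (H3 : norm (scal (/ u) (minus (S u v) v)) <= eps / (1 + M * t) + norm w).
    { eapply Rle_trans; [refine (norm_le_minus_plus _ w)|]. apply Rplus_le_compat_r, Rlt_le, H1. }
    replace (minus (S u v) v) with (scal u (scal (/ u) (minus (S u v) v))) at 1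
      by (assert (u <> 0) by lra; vector_field).
    eapply Rle_trans; [refine (norm_scal_le _ _)|]. rewrite Rabs_right by lra.
    apply Rmult_le_compat_l; lra. }
  assert (H3 : M * t * (eps / (1 + M * t)) <= eps).
  { assert (0 <= M * t) by nra. apply (Rmult_le_reg_r (1 + M * t)); [lra|].
    field_simplify; nra. }
  eapply Rle_trans; [exact Htel|].
  apply Rle_trans with (INR m * (M * (u * (norm w + eps / (1 + M * t))))).
  - apply Rmult_le_compat_l; [lra|]. now apply Rmult_le_compat_l.
  - replace (INR m * (M * (u * (norm w + eps / (1 + M * t)))))
      with (M * (INR m * u) * (norm w + eps / (1 + M * t))) by ring.
    rewrite Hut. lra.
Qed.

End Semigroups.

(** * Integrals, real powers and the Gamma function *)

(** A linear map commutes with Riemann sums, and the boundedness contained in [is_linear] lets it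
    pass to the limit. *)
Lemma is_RInt_linear {U V : NormedModule R_AbsRing} (l : U -> V) (f : R -> U) (a b : R) (If : U) :
  is_linear l -> is_RInt f a b If -> is_RInt (fun x => l (f x)) a b (l If).
Proof.
  intros Hl HI.
  assert (Hsum : forall ptd, Riemann_sum (fun x => l (f x)) ptd = l (Riemann_sum f ptd)).
  { intros ptd. induction ptd as [x0|h0 s IH] using SF_cons_ind.
    - change (zero = l zero).
      transitivity (l (scal 0 zero)).
      + rewrite (linear_scal l Hl). symmetry.
        exact (scal_zero_l (V := NormedModule.ModuleSpace R_AbsRing V) _).
      + f_equal. exact (scal_zero_l (V := NormedModule.ModuleSpace R_AbsRing U) _).
    - rewrite !Riemann_sum_cons, IH, (linear_plus l Hl), (linear_scal l Hl). reflexivity. }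
  unfold is_RInt in *.
  apply (filterlim_ext (fun ptd => l (scal (sign (b - a)) (Riemann_sum f ptd)))).
  - intros ptd. rewrite Hsum. exact (linear_scal l Hl (sign (b - a)) _).
  - eapply filterlim_comp; [exact HI|]. now apply linear_cont.
Qed.

Lemma rpow_pos_eq x a : 0 < x -> rpow x a = Rpower x a.
Proof. intros Hx. unfold rpow. destruct (Rlt_dec 0 x); [reflexivity | lra]. Qed.

Lemma rpow_nonpos_eq x a : x <= 0 -> a <> 0 -> rpow x a = 0.
Proof.
  intros Hx Ha. unfold rpow.
  destruct (Rlt_dec 0 x); [lra|]. destruct (Req_EM_T a 0); [contradiction | reflexivity].
Qed.

Lemma rpow_0_r x : rpow x 0 = 1.
Proof.
  unfold rpow. destruct (Rlt_dec 0 x); [now apply Rpower_O|].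
  destruct (Req_EM_T 0 0); [reflexivity | contradiction].
Qed.

Lemma rpow_ge_0 x a : 0 <= rpow x a.
Proof.
  unfold rpow. destruct (Rlt_dec 0 x).
  - apply Rlt_le, exp_pos.
  - destruct (Req_EM_T a 0); lra.
Qed.

Lemma rpow_lt x y a : 0 < a -> 0 <= x < y -> rpow x a < rpow y a.
Proof.
  intros Ha Hxy. rewrite (rpow_pos_eq y) by lra.
  destruct (Req_dec x 0) as [->|Hx].
  - rewrite rpow_nonpos_eq by lra. apply exp_pos.
  - rewrite rpow_pos_eq by lra. apply Rlt_Rpower_l; lra.
Qed.

Lemma rpow_le x y a : 0 < a -> 0 <= x <= y -> rpow x a <= rpow y a.
Proof.
  intros Ha Hxy. destruct (Req_dec x y) as [->|]; [lra|].
  apply Rlt_le, rpow_lt; lra.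
Qed.

Lemma rpow_mult_pos t x a : 0 < t -> rpow (t * x) a = Rpower t a * rpow x a.
Proof.
  intros Ht. unfold rpow.
  destruct (Rlt_dec 0 x), (Rlt_dec 0 (t * x)); try nra.
  - symmetry. now apply Rpower_mult_distr.
  - destruct (Req_EM_T a 0) as [->|]; [rewrite Rpower_O by auto|]; ring.
Qed.

(** The conventions of [rpow] on the nonpositive axis (0, or 1 when a = 0) are exactly the
    continuous extension. At 0 with a > 0 the radius eps^(1/a) works. *)
Lemma rpow_continuous a x : 0 <= a -> continuous (fun x => rpow x a) x.
Proof.
  intros Ha. destruct (Req_dec a 0) as [->|Hne].
  { apply (continuous_ext (fun _ => 1)); [intros; symmetry; apply rpow_0_r|].
    apply continuous_const. }
  destruct (Rtotal_order x 0) as [Hx|[->|Hx]].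
  - apply (continuous_ext_loc _ (fun _ => 0)); [|apply continuous_const].
    exists (mkposreal (- x) ltac:(lra)). intros y Hy. change (Rabs (y - x) < - x) in Hy.
    symmetry; apply rpow_nonpos_eq; auto. apply Rabs_def2 in Hy. lra.
  - apply filterlim_locally. intros [eps He].
    exists (mkposreal (Rpower eps (/ a)) (exp_pos _)). intros y Hy.
    change (Rabs (y - 0) < Rpower eps (/ a)) in Hy.
    change (Rabs (rpow y a - rpow 0 a) < eps).
    rewrite (rpow_nonpos_eq 0 a), Rminus_0_r, Rabs_right by (try apply Rle_ge, rpow_ge_0; lra).
    destruct (Rle_dec y 0) as [L|L]; [rewrite rpow_nonpos_eq; auto|].
    rewrite rpow_pos_eq by lra.
    rewrite Rminus_0_r, Rabs_right in Hy by lra.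
    replace eps with (Rpower (Rpower eps (/ a)) a).
    + apply Rlt_Rpower_l; lra.
    + rewrite Rpower_mult, Rinv_l, Rpower_1; auto.
  - apply (continuous_ext_loc _ (fun x => Rpower x a)).
    + exists (mkposreal x Hx). intros y Hy. change (Rabs (y - x) < x) in Hy.
      symmetry; apply rpow_pos_eq. apply Rabs_def2 in Hy. lra.
    + apply (ex_derive_continuous (fun x => Rpower x a)).
      exists (a * Rpower x (a - 1)). apply is_derive_Reals, derivable_pt_lim_power, Hx.
Qed.

(** * The Gamma function *)

Lemma filterlim_exp_neg_p_infty : filterlim (fun t => exp (- t)) (Rbar_locally p_infty) (locally 0).
Proof.
  apply (filterlim_comp _ _ _ (fun t => - t) exp _ (Rbar_locally m_infty)).
  - exact (filterlim_Rbar_opp p_infty).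
  - exact is_lim_exp_m.
Qed.

Lemma Gamma_1 : Gamma 1 = 1.
Proof.
  unfold Gamma. apply is_RInt_gen_unique.
  assert (HD : forall t, is_derive (fun t => - exp (- t)) t (exp (- t))).
  { intros t. auto_derive; auto. ring. }
  apply (is_RInt_gen_ext (Derive (fun t => - exp (- t)))).
  - apply filter_forall. intros [a b] t _. transitivity (exp (- t)); [apply is_derive_unique, HD|].
    unfold Rminus. rewrite Rplus_opp_r. unfold Rpower. rewrite Rmult_0_l, exp_0. now rewrite Rmult_1_l.
  - replace 1 with (0 - (-1)) by ring. apply is_RInt_gen_Derive.
    + apply filter_forall. intros [a b] t _. now exists (exp (- t)).
    + apply filter_forall. intros [a b] t _.
      apply (continuous_ext (fun t => exp (- t))); [intros; symmetry; apply is_derive_unique, HD|].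
      apply (ex_derive_continuous (fun t => exp (- t))). auto_derive. auto.
    + apply (filterlim_filter_le_1 (F := locally 0)); [apply filter_le_within|].
      replace (-1) with (- exp (- 0)) by (rewrite Ropp_0, exp_0; reflexivity).
      apply (ex_derive_continuous (fun t => - exp (- t))). auto_derive. auto.
    + replace 0 with (- 0) by ring.
      eapply filterlim_comp; [apply filterlim_exp_neg_p_infty|]. apply (filterlim_opp 0).
Qed.

Lemma rpow_le_1_plus t a : 0 <= a <= 1 -> 0 <= t -> rpow t a <= 1 + t.
Proof.
  intros Ha Ht. destruct (Req_dec t 0) as [->|Hne].
  - destruct (Req_dec a 0) as [->|]; [rewrite rpow_0_r; lra|]. rewrite rpow_nonpos_eq; lra.
  - rewrite rpow_pos_eq by lra. destruct (Rle_dec t 1) as [L|L].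
    + apply Rle_trans with (Rpower 1 a); [apply Rle_Rpower_l; lra|].
      unfold Rpower. rewrite ln_1, Rmult_0_r, exp_0. lra.
    + apply Rle_trans with (Rpower t 1); [apply Rle_Rpower; lra|]. rewrite Rpower_1; lra.
Qed.

(** The improper integral must first be shown to converge, as [Gamma] is otherwise an unspecified
    value. Using [rpow] makes the integrand continuous at 0; the partial integrals F increase and
    stay below the integral 2 of (1 + t) e^(-t), so they tend to their supremum, which is at least F
    1 > 0. *)
Lemma Gamma_pos l : 1 <= l <= 2 -> 0 < Gamma l.
Proof.
  intros Hl. set (f := fun t => rpow t (l - 1) * exp (- t)).
  assert (Hfc : forall t, continuous f t).
  { intros t. apply (continuous_mult (fun t => rpow t (l - 1)) (fun t => exp (- t))).
    - apply rpow_continuous. lra.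
    - apply (ex_derive_continuous (fun t => exp (- t))). auto_derive. auto. }
  assert (Hex : forall a b, ex_RInt f a b)
    by (intros; apply (ex_RInt_continuous (V := R_CompleteNormedModule)); auto).
  set (F := fun b : R => RInt f 0 b : R).
  assert (HF : forall t, is_derive F t (f t)).
  { intros t. apply (is_derive_RInt f F 0 t).
    - apply filter_forall. intros b. apply (RInt_correct (V := R_CompleteNormedModule)), Hex.
    - apply Hfc. }
  assert (Hmono : forall a b, 0 <= a <= b -> F a <= F b).
  { intros a b Hab. unfold F. rewrite <- (RInt_Chasles f 0 a b) by auto.
    assert (0 <= RInt f a b); [|change (RInt f 0 a <= RInt f 0 a + RInt f a b); lra].
    apply RInt_ge_0; [lra | auto |]. intros x Hx.
    apply Rmult_le_pos; [apply rpow_ge_0 | apply Rlt_le, exp_pos]. }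
  assert (Hbd : forall b, 0 <= b -> F b <= 2).
  { intros b Hb.
    set (g := fun t => (1 + t) * exp (- t)).
    assert (HI : is_RInt g 0 b (minus (- (2 + b) * exp (- b)) (- (2 + 0) * exp (- 0)))).
    { apply (is_RInt_derive (fun t => - (2 + t) * exp (- t)) g).
      - intros x _. unfold g. auto_derive; auto. ring.
      - intros x _. apply (ex_derive_continuous g). unfold g. auto_derive. auto. }
    apply Rle_trans with (RInt g 0 b).
    - apply RInt_le; auto. + eexists; exact HI. + intros x Hx. unfold f, g.
      apply Rmult_le_compat_r; [apply Rlt_le, exp_pos|]. apply rpow_le_1_plus; lra.
    - rewrite (is_RInt_unique _ _ _ _ HI).
      change (- (2 + b) * exp (- b) - (- (2 + 0) * exp (- 0)) <= 2).
      rewrite Ropp_0, exp_0. pose proof (exp_pos (- b)). nra. }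
  destruct (completeness (fun y => exists b, 0 <= b /\ y = F b)) as [L [Hub Hlub]].
  { exists 2. intros y [b [Hb ->]]. auto. }
  { exists (F 0), 0. split; [lra | reflexivity]. }
  assert (HF0 : F 0 = 0) by exact (RInt_point (V := R_CompleteNormedModule) 0 f).
  assert (HL : is_RInt_gen (Derive F) (at_right 0) (Rbar_locally p_infty) (L - 0)).
  { apply is_RInt_gen_Derive.
    - apply filter_forall. intros [a b] t _. now exists (f t).
    - apply filter_forall. intros [a b] t _.
      apply (continuous_ext f); [intros; symmetry; apply is_derive_unique, HF | auto].
    - rewrite <- HF0 at 2. apply (filterlim_filter_le_1 (F := locally 0)); [apply filter_le_within|].
      apply (ex_derive_continuous F). now exists (f 0).
    - apply filterlim_locally. intros [eps He].
      destruct (classic (exists b, 0 <= b /\ L - eps < F b)) as [[b [Hb1 Hb2]]|Hn].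
      + exists b. intros y Hy. change (Rabs (F y - L) < eps).
        assert (F y <= L) by (apply Hub; exists y; split; [lra | reflexivity]).
        assert (F b <= F y) by (apply Hmono; lra).
        apply Rabs_def1; lra.
      + exfalso. assert (L <= L - eps); [|lra].
        apply Hlub. intros y [b [Hb ->]]. apply Rnot_lt_le. intros Hlt. apply Hn. now exists b. }
  rewrite Rminus_0_r in HL.
  replace (Gamma l) with L.
  - apply Rlt_le_trans with (F 1).
    + apply RInt_gt_0; [lra | | auto]. intros x Hx. apply Rmult_lt_0_compat; [|apply exp_pos].
      rewrite rpow_pos_eq by lra. apply exp_pos.
    + apply Hub. exists 1. split; [lra | reflexivity].
  - symmetry. unfold Gamma. apply is_RInt_gen_unique.
    apply (is_RInt_gen_ext (Derive F)); [|exact HL].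
    exists (fun a => 0 < a) (fun b => 0 < b).
    + exists (mkposreal 1 Rlt_0_1). auto.
    + exists 0. auto.
    + intros a b Ha Hb x Hx. simpl in Hx.
      assert (0 < x) by (apply Rlt_trans with (Rmin a b); [now apply Rmin_glb_lt | tauto]).
      rewrite (is_derive_unique _ _ _ (HF x)). unfold f. now rewrite rpow_pos_eq.
Qed.

(** * Variation of constants for the exact solution and for the scheme *)

Section Duhamel.
Context {X : CompleteNormedModule R_AbsRing} (S : R -> X -> X) (HS : C0_semigroup S).

Lemma duhamel_ex_RInt (f : R -> X) (a b c : R) :
  (forall s, continuous f s) -> a <= b <= c -> ex_RInt (fun s => S (c - s) (f s)) a b.
Proof.
  intros Hf Habc.
  apply (ex_RInt_ext (fun s => S (Rmax 0 (c - s)) (f s))).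
  - rewrite Rmin_left, Rmax_right by lra. intros x Hx. rewrite Rmax_right; [reflexivity | lra].
  - apply ex_RInt_continuous. intros s _.
    apply (semigroup_apply_continuous S HS f (fun s => c - s)); auto.
    apply (ex_derive_continuous (fun s => c - s)). auto_derive. auto.
Qed.

(** On [0, t] the factor [S tau] splits off by the semigroup law and leaves the integral because it
    is bounded and linear. *)
Lemma duhamel_split (f : R -> X) (t tau : R) :
  (forall s, continuous f s) -> 0 <= t -> 0 <= tau ->
  RInt (fun s => S (t + tau - s) (f s)) 0 (t + tau) =
  plus (S tau (RInt (fun s => S (t - s) (f s)) 0 t))
       (RInt (fun s => S (t + tau - s) (f s)) t (t + tau)).
Proof.
  intros Hf Ht Htau.
  rewrite <- (RInt_Chasles (fun s => S (t + tau - s) (f s)) 0 t (t + tau))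
    by (apply duhamel_ex_RInt; auto; lra).
  f_equal. apply is_RInt_unique.
  apply (is_RInt_ext (fun s => S tau (S (t - s) (f s)))).
  - rewrite Rmin_left, Rmax_right by lra. intros x Hx.
    destruct HS as (_ & _ & _ & _ & Ha & _). rewrite <- Ha by lra. f_equal. ring.
  - apply (is_RInt_linear (S tau)).
    + now apply semigroup_linear.
    + apply (RInt_correct (V := X)), duhamel_ex_RInt; auto; lra.
Qed.

Lemma duhamel_minus (f g : R -> X) (a b c : R) :
  (forall s, continuous f s) -> (forall s, continuous g s) -> a <= b <= c ->
  RInt (fun s => S (c - s) (minus (f s) (g s))) a b =
  minus (RInt (fun s => S (c - s) (f s)) a b) (RInt (fun s => S (c - s) (g s)) a b).
Proof.
  intros Hf Hg Habc.
  rewrite <- (RInt_minus (V := X)) by (apply duhamel_ex_RInt; auto).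
  apply RInt_ext. rewrite Rmin_left, Rmax_right by lra.
  intros x Hx. apply semigroup_minus; auto. lra.
Qed.

Lemma rpow_scal_continuous (a : R) (v : X) s : 0 <= a -> continuous (fun s => scal (rpow s a) v) s.
Proof.
  intros Ha. apply (continuous_scal_l (fun s => rpow s a) v s). now apply rpow_continuous.
Qed.

(** Substitution s = t theta: the factor t from ds and t^(l-1) from the weight make up t^l. With l
    >= 1 the weight is continuous at 0 and the integral is a proper one. *)
Lemma scal_phi (l t : R) (v : X) : 1 <= l -> Gamma l <> 0 -> 0 < t ->
  scal (Gamma l * rpow t l) (phi S l t v) = RInt (fun s => S (t - s) (scal (rpow s (l - 1)) v)) 0 t.
Proof.
  intros Hl HG Ht. unfold phi.
  set (F := fun th => scal (rpow th (l - 1)) (S ((1 - th) * t) v)).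
  set (I := RInt (fun s => S (t - s) (scal (rpow s (l - 1)) v)) 0 t).
  assert (HI : is_RInt (fun s => S (t - s) (scal (rpow s (l - 1)) v)) (t * 0 + 0) (t * 1 + 0) I).
  { rewrite Rmult_0_r, Rmult_1_r, !Rplus_0_r. apply (RInt_correct (V := X)).
    apply duhamel_ex_RInt; [|lra]. intros s. apply rpow_scal_continuous. lra. }
  apply is_RInt_comp_lin in HI.
  assert (Htl : 0 < Rpower t l) by apply exp_pos.
  assert (Hpow : t * Rpower t (l - 1) = Rpower t l).
  { rewrite <- (Rpower_1 t) at 1 by auto. rewrite <- Rpower_plus. f_equal. ring. }
  assert (HF : is_RInt F 0 1 (scal (/ Rpower t l) I)).
  { eapply is_RInt_ext; [|apply (is_RInt_scal _ _ _ (/ Rpower t l) _ HI)].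
    rewrite Rmin_left, Rmax_right by lra. intros x Hx. simpl.
    rewrite Rplus_0_r, rpow_mult_pos by auto.
    replace (t - t * x) with ((1 - x) * t) by ring.
    destruct HS as (_ & Hs & _). rewrite Hs by nra. unfold F.
    set (w := S ((1 - x) * t) v).
    transitivity (scal (/ Rpower t l * (t * Rpower t (l - 1)) * rpow x (l - 1)) w); [vector|].
    rewrite Hpow, Rinv_l by lra. vector. }
  rewrite (is_RInt_unique _ _ _ _ HF), rpow_pos_eq by auto.
  assert (Rpower t l <> 0) by lra. vector_field.
Qed.

Lemma duhamel_const_shift (v : X) (t tau : R) : 0 <= tau ->
  RInt (fun s => S (tau - s) v) 0 tau = RInt (fun s => S (t + tau - s) v) t (t + tau).
Proof.
  intros Htau. symmetry. apply is_RInt_unique.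
  assert (HI : is_RInt (fun s => S (tau - s) v) (1 * t + - t) (1 * (t + tau) + - t)
                 (RInt (fun s => S (tau - s) v) 0 tau)).
  { replace (1 * t + - t) with 0 by ring. replace (1 * (t + tau) + - t) with tau by ring.
    apply (RInt_correct (V := X)). apply (duhamel_ex_RInt (fun _ => v)); [|lra].
    intros s. apply continuous_const. }
  apply is_RInt_comp_lin in HI.
  eapply is_RInt_ext; [|exact HI].
  intros x _. simpl. replace (tau - (1 * x + - t)) with (t + tau - x) by ring.
  set (w := S (t + tau - x) v). vector.
Qed.

(** The two fractional terms are the convolutions of s^r with the semigroup over [0, tn + tau] and,
    propagated by [S tau], over [0, tn]. By [duhamel_split] their difference is the integral over
    the current step alone. *)
Lemma eqrf2_step_duhamel (h : R -> X) (r c1 c2 tau tn : R) (yn : X) :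
  0 < r < 1 -> 0 < tau -> 0 <= tn ->
  eqrf2_step S h r c1 c2 tau tn yn =
  plus (S tau yn)
    (RInt (fun s => S (tn + tau - s)
       (plus (alpha0 h r c1 c2 tn tau) (scal (rpow s r) (alpha1 h r c1 c2 tn tau)))) tn (tn + tau)).
Proof.
  intros Hr Htau Htn. unfold eqrf2_step.
  set (a0 := alpha0 h r c1 c2 tn tau). set (a1 := alpha1 h r c1 c2 tn tau).
  assert (HG : Gamma (1 + r) <> 0) by (pose proof (Gamma_pos (1 + r)); lra).
  assert (E0 : scal tau (phi S 1 tau a0) = RInt (fun s => S (tn + tau - s) a0) tn (tn + tau)).
  { rewrite <- duhamel_const_shift by lra.
    transitivity (scal (Gamma 1 * rpow tau 1) (phi S 1 tau a0)).
    - rewrite Gamma_1, rpow_pos_eq, Rpower_1, Rmult_1_l by auto. reflexivity.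
    - rewrite scal_phi; auto; [|lra|rewrite Gamma_1; lra].
      apply RInt_ext. intros x _. unfold Rminus at 2. rewrite Rplus_opp_r, rpow_0_r.
      f_equal. vector. }
  assert (E1 : forall t, 0 <= t -> scal (Gamma (1 + r)) (scal (rpow t (1 + r)) (phi S (1 + r) t a1))
                  = RInt (fun s => S (t - s) (scal (rpow s r) a1)) 0 t).
  { intros t Ht. set (p := phi S (1 + r) t a1).
    transitivity (scal (Gamma (1 + r) * rpow t (1 + r)) p); [vector|].
    destruct (Req_dec t 0) as [->|Hne].
    - rewrite RInt_point, rpow_nonpos_eq, Rmult_0_r by lra. vector.
    - unfold p. rewrite scal_phi by lra. replace (1 + r - 1) with r by ring. reflexivity. }
  assert (E2 : scal (Gamma (1 + r)) (minus (scal (rpow (tn + tau) (1 + r)) (phi S (1 + r) (tn + tau) a1))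
             (scal (rpow tn (1 + r)) (S tau (phi S (1 + r) tn a1))))
          = RInt (fun s => S (tn + tau - s) (scal (rpow s r) a1)) tn (tn + tau)).
  { transitivity (minus (RInt (fun s => S (tn + tau - s) (scal (rpow s r) a1)) 0 (tn + tau))
                    (S tau (RInt (fun s => S (tn - s) (scal (rpow s r) a1)) 0 tn))).
    - rewrite <- !E1 by lra. destruct HS as (_ & Hs & _). rewrite !Hs by lra.
      set (p := phi S (1 + r) (tn + tau) a1). set (q := S tau (phi S (1 + r) tn a1)). vector.
    - rewrite (duhamel_split (fun s => scal (rpow s r) a1)); [|intros; apply rpow_scal_continuous; lra|lra|lra].
      match goal with |- minus (plus ?u ?v) ?u' = ?v' => set (p := u); set (q := v) end. vector. }
  rewrite E0, E2.
  transitivity (plus (S tau yn) (plus (RInt (fun s => S (tn + tau - s) a0) tn (tn + tau))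
    (RInt (fun s => S (tn + tau - s) (scal (rpow s r) a1)) tn (tn + tau)))).
  { match goal with |- plus (plus ?u ?v) ?w = _ => set (p := u); set (q := v); set (z := w) end. vector. }
  f_equal. rewrite <- (RInt_plus (V := X)).
  - apply RInt_ext. rewrite Rmin_left, Rmax_right by lra. intros x Hx.
    destruct HS as (Hp & _). rewrite Hp by lra. reflexivity.
  - apply (duhamel_ex_RInt (fun _ => a0)); [|lra]. intros s. apply continuous_const.
  - apply (duhamel_ex_RInt (fun s => scal (rpow s r) a1)); [|lra].
    intros s. apply rpow_scal_continuous. lra.
Qed.

Lemma eqrf2_error_step (h : R -> X) (r c1 c2 tau tn : R) (y0 yn : X) :
  0 < r < 1 -> 0 < tau -> 0 <= tn -> (forall s, continuous (fun s => h (rpow s r)) s) ->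
  minus (mild_sol S h r y0 (tn + tau)) (eqrf2_step S h r c1 c2 tau tn yn) =
  plus (S tau (minus (mild_sol S h r y0 tn) yn))
    (RInt (fun s => S (tn + tau - s) (minus (h (rpow s r))
       (plus (alpha0 h r c1 c2 tn tau) (scal (rpow s r) (alpha1 h r c1 c2 tn tau))))) tn (tn + tau)).
Proof.
  intros Hr Htau Htn Hc.
  set (a0 := alpha0 h r c1 c2 tn tau). set (a1 := alpha1 h r c1 c2 tn tau).
  rewrite eqrf2_step_duhamel by auto. fold a0 a1.
  rewrite (duhamel_minus (fun s => h (rpow s r)) (fun s => plus a0 (scal (rpow s r) a1)));
    [|auto| |lra].
  2:{ intros s. apply (continuous_plus (V := CompleteNormedModule.NormedModule R_AbsRing X)
        (fun _ => a0) (fun s => scal (rpow s r) a1));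
        [apply continuous_const | apply rpow_scal_continuous; lra]. }
  rewrite (semigroup_minus S HS) by lra. unfold mild_sol.
  rewrite (duhamel_split (fun s => h (rpow s r))) by (auto; lra).
  destruct HS as (Hp & _ & _ & _ & Ha & _).
  rewrite Hp by lra. rewrite (Rplus_comm tn tau), Ha by lra.
  repeat match goal with |- context [RInt ?f ?a ?b] => generalize (RInt f a b); intro end.
  repeat match goal with |- context [S tau ?u] => generalize (S tau u); intro end.
  vector.
Qed.

End Duhamel.

(** * The local error *)

Lemma Rpower_is_derive x a : 0 < x -> is_derive (fun x => Rpower x a) x (a * Rpower x (a - 1)).
Proof. intros Hx. now apply is_derive_Reals, derivable_pt_lim_power. Qed.

Lemma Rpower_le_neg x y a : a <= 0 -> 0 < x <= y -> Rpower y a <= Rpower x a.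
Proof.
  intros Ha Hxy. replace a with (- (- a)) by ring. rewrite !(Rpower_Ropp _ (- a)).
  apply Rinv_le_contravar; [apply exp_pos | apply Rle_Rpower_l; lra].
Qed.

Lemma Rmin_Rmax_between a b l u z :
  l <= a <= u -> l <= b <= u -> Rmin a b <= z <= Rmax a b -> l <= z <= u.
Proof.
  unfold Rmin, Rmax. destruct (Rle_dec a b); lra.
Qed.

Lemma mvt_Rabs_le (f df : R -> R) (l u K x y : R) :
  (forall z, l <= z <= u -> is_derive f z (df z)) ->
  (forall z, l <= z <= u -> Rabs (df z) <= K) ->
  l <= x <= u -> l <= y <= u -> Rabs (f x - f y) <= K * Rabs (x - y).
Proof.
  intros Hd HK Hx Hy.
  destruct (MVT_gen f y x df) as [c [Hc E]].
  - intros z Hz. apply Hd. apply (Rmin_Rmax_between y x); auto; lra.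
  - intros z Hz. apply continuity_pt_filterlim, (ex_derive_continuous f).
    eexists. apply Hd. apply (Rmin_Rmax_between y x); auto; lra.
  - rewrite E, Rabs_mult. apply Rmult_le_compat_r; [apply Rabs_pos|].
    apply HK. apply (Rmin_Rmax_between y x); auto.
Qed.

Lemma Rpower_increment_le t u r x y : 0 < t -> 0 < r < 1 ->
  t <= x <= u -> t <= y <= u ->
  Rabs (Rpower x r - Rpower y r) <= Rpower t (r - 1) * Rabs (x - y).
Proof.
  intros Ht Hr.
  apply (mvt_Rabs_le (fun x => Rpower x r) (fun x => r * Rpower x (r - 1))).
  - intros z Hz. apply Rpower_is_derive. lra.
  - intros z Hz. assert (Rpower z (r - 1) <= Rpower t (r - 1)) by (apply Rpower_le_neg; lra).
    pose proof (exp_pos ((r - 1) * ln z)) as Hp. fold (Rpower z (r - 1)) in Hp.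
    rewrite Rabs_right; nra.
Qed.

(** The mean value theorem is used twice: for x^r minus a line of slope r t^(r-1), and for the
    difference of derivatives, where |(r-1) w^(r-2)| <= t^(r-2). The factors r and 1 - r are bounded
    by 1. *)
Lemma Rpower_increment_linear t tau r x y : 0 < t -> 0 < r < 1 ->
  t <= x <= t + tau -> t <= y <= t + tau ->
  Rabs (Rpower x r - Rpower y r - r * Rpower t (r - 1) * (x - y))
    <= Rpower t (r - 2) * tau * Rabs (x - y).
Proof.
  intros Ht Hr Hx Hy.
  replace (Rpower x r - Rpower y r - r * Rpower t (r - 1) * (x - y)) with
    ((Rpower x r - r * Rpower t (r - 1) * x) - (Rpower y r - r * Rpower t (r - 1) * y)) by ring.
  apply (mvt_Rabs_le (fun x => Rpower x r - r * Rpower t (r - 1) * x)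
           (fun x => r * Rpower x (r - 1) - r * Rpower t (r - 1)) t (t + tau)); auto.
  - intros z Hz.
    apply (is_derive_minus (fun x => Rpower x r) (fun x => r * Rpower t (r - 1) * x)).
    + apply Rpower_is_derive. lra.
    + auto_derive; auto. ring.
  - intros z Hz.
    replace (r * Rpower z (r - 1) - r * Rpower t (r - 1))
      with (r * (Rpower z (r - 1) - Rpower t (r - 1))) by ring.
    assert (H : Rabs (Rpower z (r - 1) - Rpower t (r - 1)) <= Rpower t (r - 2) * Rabs (z - t)).
    { apply (mvt_Rabs_le (fun x => Rpower x (r - 1)) (fun x => (r - 1) * Rpower x (r - 1 - 1))
               t (t + tau)); try lra.
      - intros w Hw. apply Rpower_is_derive. lra.
      - intros w Hw. replace (r - 1 - 1) with (r - 2) by ring.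
        assert (Rpower w (r - 2) <= Rpower t (r - 2)) by (apply Rpower_le_neg; lra).
        pose proof (exp_pos ((r - 2) * ln w)) as Hp. fold (Rpower w (r - 2)) in Hp.
        rewrite Rabs_left; nra. }
    rewrite (Rabs_right (z - t)) in H by lra.
    rewrite Rabs_mult, (Rabs_right r) by lra.
    pose proof (exp_pos ((r - 2) * ln t)) as Hp. fold (Rpower t (r - 2)) in Hp.
    pose proof (Rabs_pos (Rpower z (r - 1) - Rpower t (r - 1))).
    assert (Rpower t (r - 2) * (z - t) <= Rpower t (r - 2) * tau)
      by (apply Rmult_le_compat_l; lra).
    nra.
Qed.

(** Integral test in telescoping form: the mean value theorem for x^(-eps) on [n - 1, n], whose
    derivative is largest in size at the left. The bound n >= 2 keeps the interval away from 0. *)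
Lemma inv_power_telescope n eps : (2 <= n)%nat -> 0 < eps ->
  Rpower (INR n) (- eps - 1) <= / eps * (Rpower (INR n - 1) (- eps) - Rpower (INR n) (- eps)).
Proof.
  intros Hn He. apply le_INR in Hn. simpl in Hn.
  destruct (MVT_gen (fun x => Rpower x (- eps)) (INR n - 1) (INR n)
              (fun x => - eps * Rpower x (- eps - 1))) as [c [Hc E]].
  - rewrite Rmin_left, Rmax_right by lra. intros z Hz. apply Rpower_is_derive. lra.
  - rewrite Rmin_left, Rmax_right by lra. intros z Hz.
    apply continuity_pt_filterlim, (ex_derive_continuous (fun x => Rpower x (- eps))).
    eexists. apply Rpower_is_derive. lra.
  - rewrite Rmin_left, Rmax_right in Hc by lra.
    assert (Rpower (INR n) (- eps - 1) <= Rpower c (- eps - 1)) by (apply Rpower_le_neg; lra).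
    replace (Rpower (INR n - 1) (- eps) - Rpower (INR n) (- eps)) with (eps * Rpower c (- eps - 1))
      by lra.
    rewrite <- Rmult_assoc, Rinv_l; lra.
Qed.

(** Size of the n-th local error in units of tau^(1+2r); the value 1 at n = 0 stands for the
    separately treated first step, where the power would be singular. *)
Definition step_weight (r : R) (n : nat) : R :=
  match n with O => 1 | _ => Rpower (INR n) (2 * r - 3) end.

(** An explicit majorant B of the partial sums, stated through its increments so that the error
    induction adds one weight at a time. With eps = 2 - 2r the exponent 2r - 3 is -eps - 1; the
    constant 2 in B collects the weights of steps 0 and 1, and the telescoping sum adds at most
    1/eps. *)
Lemma step_weight_sum_bounded r : 0 < r < 1 -> exists (B : nat -> R) (W : R),
  B O = 0 /\ (forall n, B n <= W) /\ (forall n, B n + step_weight r n <= B (Datatypes.S n)).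
Proof.
  intros Hr. set (eps := 2 - 2 * r).
  assert (He : 0 < eps) by (unfold eps; lra).
  assert (Hie : 0 < / eps) by now apply Rinv_0_lt_compat.
  exists (fun n => match n with
    | O => 0 | Datatypes.S O => 1
    | Datatypes.S (Datatypes.S m as k) => 2 + / eps * (1 - Rpower (INR k) (- eps)) end).
  exists (2 + / eps). split; [reflexivity|]. split.
  - intros [|[|n]]; try lra.
    pose proof (exp_pos (- eps * ln (INR (Datatypes.S n)))) as Hp.
    fold (Rpower (INR (Datatypes.S n)) (- eps)) in Hp. nra.
  - assert (H1 : forall a, Rpower (INR 1) a = 1).
    { intros a. unfold Rpower. simpl INR. now rewrite ln_1, Rmult_0_r, exp_0. }
    intros [|[|n]]; unfold step_weight.
    + lra.
    + rewrite !H1. lra.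
    + pose proof (inv_power_telescope (Datatypes.S (Datatypes.S n)) eps ltac:(lia) He) as H.
      replace (2 * r - 3) with (- eps - 1) by (unfold eps; ring).
      replace (INR (Datatypes.S (Datatypes.S n)) - 1) with (INR (Datatypes.S n)) in H
        by (rewrite (S_INR (Datatypes.S n)); ring).
      lra.
Qed.

Section LocalError.
Context {X : CompleteNormedModule R_AbsRing} (S : R -> X -> X) (HS : C0_semigroup S).
Context (h h1 h2 h3 : R -> X) (T r c1 c2 M M2 M3 MA : R).
Context (Hr : 0 < r < 1) (Hc1 : 0 <= c1 <= 1) (Hc2 : 0 <= c2 <= 1).
Context (Hc : c1 <> c2).
Context (HM1 : 1 <= M).
Context (HM : forall t (x : X), 0 <= t <= T -> norm (S t x) <= M * norm x).
Context (D1 : has_deriv_nonneg h h1) (D2 : has_deriv_nonneg h1 h2) (D3 : has_deriv_nonneg h2 h3).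
Context (HM2 : forall x, 0 <= x -> norm (h2 x) <= M2).
Context (HM3 : forall x, 0 <= x -> norm (h3 x) <= M3).

Definition interp_defect (t tau s : R) : X :=
  minus (h (rpow s r)) (plus (alpha0 h r c1 c2 t tau) (scal (rpow s r) (alpha1 h r c1 c2 t tau))).

Lemma h_rpow_continuous s : continuous (fun s => h (rpow s r)) s.
Proof.
  refine (proj2 (filterlim_locally_ball_norm (K := R_AbsRing)
    (U := CompleteNormedModule.NormedModule R_AbsRing X) _ _) _).
  intros [eps He].
  destruct (D1 (rpow s r) (rpow_ge_0 s r) 1 Rlt_0_1) as [d [Hd Hd']].
  pose proof (norm_ge_0 (h1 (rpow s r))) as Hn.
  assert (He' : 0 < eps / (1 + norm (h1 (rpow s r)))) by (apply Rdiv_lt_0_compat; lra).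
  assert (Hm : 0 < Rmin d (eps / (1 + norm (h1 (rpow s r))))) by now apply Rmin_glb_lt.
  pose proof (proj1 (filterlim_locally _ _) (rpow_continuous r s (Rlt_le _ _ (proj1 Hr))) (mkposreal _ Hm)) as N.
  revert N. apply filter_imp. intros u Hu.
  change (Rabs (rpow u r - rpow s r) < Rmin d (eps / (1 + norm (h1 (rpow s r))))) in Hu.
  change (norm (minus (h (rpow u r)) (h (rpow s r))) < eps).
  assert (Hu1 : Rabs (rpow u r - rpow s r) < d)
    by (eapply Rlt_le_trans; [exact Hu | apply Rmin_l]).
  assert (Hu2 : Rabs (rpow u r - rpow s r) < eps / (1 + norm (h1 (rpow s r))))
    by (eapply Rlt_le_trans; [exact Hu | apply Rmin_r]).
  specialize (Hd' (rpow u r) (rpow_ge_0 u r) Hu1).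
  set (D := rpow u r - rpow s r) in *.
  assert (H1 : norm (minus (h (rpow u r)) (h (rpow s r))) <= 1 * Rabs D + Rabs D * norm (h1 (rpow s r))).
  { eapply Rle_trans; [refine (norm_le_minus_plus _ (scal D (h1 (rpow s r))))|].
    apply Rplus_le_compat; [exact Hd' | refine (norm_scal_le _ _)]. }
  eapply Rle_lt_trans; [exact H1|].
  apply Rlt_le_trans with (eps / (1 + norm (h1 (rpow s r))) * (1 + norm (h1 (rpow s r)))).
  - replace (1 * Rabs D + Rabs D * norm (h1 (rpow s r)))
      with (Rabs D * (1 + norm (h1 (rpow s r)))) by ring.
    apply Rmult_lt_compat_r; lra.
  - apply Req_le. field. lra.
Qed.

Lemma interp_defect_continuous t tau s : continuous (interp_defect t tau) s.
Proof.
  apply (continuous_minus (V := CompleteNormedModule.NormedModule R_AbsRing X)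
           (fun s => h (rpow s r))
           (fun s => plus (alpha0 h r c1 c2 t tau) (scal (rpow s r) (alpha1 h r c1 c2 t tau)))).
  - apply h_rpow_continuous.
  - apply (continuous_plus (V := CompleteNormedModule.NormedModule R_AbsRing X)
             (fun _ => alpha0 h r c1 c2 t tau)
             (fun s => scal (rpow s r) (alpha1 h r c1 c2 t tau))).
    + apply continuous_const.
    + apply rpow_scal_continuous. lra.
Qed.

Lemma interp_defect_le t tau s D : 0 <= t -> 0 < tau ->
  let p1 := rpow (t + c1 * tau) r in let p2 := rpow (t + c2 * tau) r in
  Rabs (rpow s r - p1) <= D -> Rabs (p2 - p1) <= D ->
  norm (minus (interp_defect t tau s)
          (scal (/ 2 * ((rpow s r - p1) * (rpow s r - p2))) (h2 p1))) <= 2 * M3 * D ^ 3.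
Proof.
  intros Ht Htau p1 p2 H1 H2.
  apply (linear_interpolation_error h h1 h2 h3); auto; try apply rpow_ge_0.
  intros E. unfold p1, p2 in E.
  destruct (Rtotal_order c1 c2) as [L|[L|L]]; [|contradiction|].
  - pose proof (rpow_lt (t + c1 * tau) (t + c2 * tau) r). nra.
  - pose proof (rpow_lt (t + c2 * tau) (t + c1 * tau) r). nra.
Qed.

(** Both nodes and all values of s^r lie in [0, d] with d = tau^r, so the quadratic term is at most
    M2 d^2 and the cubic one at most 2 M3 T^r d^2. Integration over length tau supplies the
    remaining power. *)
Lemma local_error_first tau : 0 < tau <= T ->
  norm (RInt (fun s => S (0 + tau - s) (interp_defect 0 tau s)) 0 (0 + tau))
    <= M * (2 * M3 * Rpower T r + M2) * Rpower tau (1 + 2 * r).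
Proof.
  intros Htau. rewrite Rplus_0_l.
  assert (M30 : 0 <= M3) by exact (Rle_trans _ _ _ (norm_ge_0 _) (HM3 0 (Rle_refl 0))).
  assert (M20 : 0 <= M2) by exact (Rle_trans _ _ _ (norm_ge_0 _) (HM2 0 (Rle_refl 0))).
  set (d := Rpower tau r).
  assert (Hd : 0 < d) by apply exp_pos.
  assert (HdT : d <= Rpower T r) by (apply Rle_Rpower_l; lra).
  assert (Hrange : forall s, 0 <= s <= tau -> 0 <= rpow s r <= d).
  { intros s Hs. split; [apply rpow_ge_0|]. unfold d.
    rewrite <- rpow_pos_eq by lra. apply rpow_le; lra. }
  assert (Hdiff : forall s u, 0 <= s <= tau -> 0 <= u <= tau -> Rabs (rpow s r - rpow u r) <= d).
  { intros s u Hs Hu. pose proof (Hrange s Hs). pose proof (Hrange u Hu).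
    apply Rabs_le. lra. }
  assert (Hpt : forall s, 0 <= s <= tau ->
    norm (S (tau - s) (interp_defect 0 tau s)) <= M * (2 * M3 * Rpower T r + M2) * d ^ 2).
  { intros s Hs.
    eapply Rle_trans; [apply HM; lra|]. rewrite Rmult_assoc. apply Rmult_le_compat_l; [lra|].
    assert (Hp1 : 0 <= 0 + c1 * tau <= tau) by nra.
    assert (Hp2 : 0 <= 0 + c2 * tau <= tau) by nra.
    pose proof (interp_defect_le 0 tau s d ltac:(lra) ltac:(lra)
                  (Hdiff _ _ Hs Hp1) (Hdiff _ _ Hp2 Hp1)) as HE.
    set (p1 := rpow (0 + c1 * tau) r) in *. set (p2 := rpow (0 + c2 * tau) r) in *.
    set (k := / 2 * ((rpow s r - p1) * (rpow s r - p2))) in *.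
    assert (Hk : Rabs k <= d ^ 2).
    { unfold k. rewrite !Rabs_mult, (Rabs_right (/ 2)) by lra.
      pose proof (Hdiff _ _ Hs Hp1) as A1. pose proof (Hdiff _ _ Hs Hp2) as A2.
      fold p1 in A1. fold p2 in A2.
      assert (Rabs (rpow s r - p1) * Rabs (rpow s r - p2) <= d * d)
        by (apply Rmult_le_compat; auto using Rabs_pos).
      nra. }
    assert (Hv : norm (scal k (h2 p1)) <= d ^ 2 * M2).
    { eapply Rle_trans; [refine (norm_scal_le _ _)|].
      apply Rmult_le_compat; auto using Rabs_pos. apply norm_ge_0. apply HM2, rpow_ge_0. }
    assert (Hd3 : 2 * M3 * d ^ 3 <= 2 * M3 * (Rpower T r * d ^ 2)).
    { apply Rmult_le_compat_l; [lra|]. replace (d ^ 3) with (d * d ^ 2) by ring.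
      apply Rmult_le_compat_r; [apply pow2_ge_0 | auto]. }
    eapply Rle_trans; [refine (norm_le_minus_plus _ (scal k (h2 p1)))|].
    eapply Rle_trans; [apply Rplus_le_compat; [exact HE | exact Hv]|]. lra. }
  assert (HI := norm_RInt_le_const _ 0 tau _ _ (Rlt_le _ _ (proj1 Htau)) Hpt
     (RInt_correct (V := X) _ 0 tau (duhamel_ex_RInt S HS _ 0 tau tau
        (interp_defect_continuous 0 tau) ltac:(lra)))).
  eapply Rle_trans; [exact HI|]. apply Req_le.
  replace (1 + 2 * r) with (1 + (r + r)) by ring.
  rewrite !Rpower_plus, Rpower_1 by lra. fold d. ring.
Qed.

Context (HMA : forall x, 0 <= x -> exists w, gen_graph S (h2 x) w /\ norm w <= MA).
Context (Hquad : / 3 - / 2 * (c1 + c2) + c1 * c2 = 0).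

(** The scalar integral equals k tau^3 (1/3 - (c1 + c2)/2 + c1 c2), which is where the condition on
    the nodes enters. *)
Lemma quadrature_kernel_RInt t tau (k : R) (v : X) :
  is_RInt (fun s => scal (k * ((s - t - c1 * tau) * (s - t - c2 * tau))) v) t (t + tau) zero.
Proof.
  set (P := fun s => k * ((s - t) ^ 3 / 3 - (c1 + c2) * tau * (s - t) ^ 2 / 2
                          + c1 * c2 * tau ^ 2 * (s - t))).
  assert (HP : is_RInt (fun s => k * ((s - t - c1 * tau) * (s - t - c2 * tau))) t (t + tau)
                 (minus (P (t + tau)) (P t))).
  { apply (is_RInt_derive P).
    - intros x _. unfold P. auto_derive; auto. field.
    - intros x _.
      apply (ex_derive_continuous (fun s => k * ((s - t - c1 * tau) * (s - t - c2 * tau)))).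
      auto_derive. auto. }
  apply (is_RInt_linear (fun k : R => scal k v) _ _ _ _ (is_linear_scal_l v)) in HP.
  match type of HP with is_RInt _ _ _ ?I => assert (Z : I = zero); [|rewrite Z in HP; exact HP] end.
  replace (minus (P (t + tau)) (P t)) with 0.
  - exact (scal_zero_l (V := CompleteNormedModule.ModuleSpace R_AbsRing X) v).
  - change (0 = P (t + tau) - P t). unfold P.
    transitivity (k * tau ^ 3 * (/ 3 - / 2 * (c1 + c2) + c1 * c2)); [rewrite Hquad; ring | field].
Qed.

(* The condition on c1, c2 kills the integral of the frozen quadratic term, so only the
   deviation of the semigroup from the identity on h''(p1) in D(A) survives there. *)
Lemma local_error_later t tau : 0 < t -> 0 < tau -> t + tau <= T ->
  norm (RInt (fun s => S (t + tau - s) (interp_defect t tau s)) t (t + tau))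
    <= M * (2 * M3 * Rpower T r + M2 + MA * T) * (Rpower t (2 * r - 3) * tau ^ 4).
Proof.
  intros Ht Htau HtT.
  assert (M30 : 0 <= M3) by exact (Rle_trans _ _ _ (norm_ge_0 _) (HM3 0 (Rle_refl 0))).
  assert (M20 : 0 <= M2) by exact (Rle_trans _ _ _ (norm_ge_0 _) (HM2 0 (Rle_refl 0))).
  set (p1 := rpow (t + c1 * tau) r). set (p2 := rpow (t + c2 * tau) r).
  set (v := h2 p1).
  destruct (HMA p1 (rpow_ge_0 _ _)) as [w [Hw1 Hw2]]. fold v in Hw1.
  assert (MA0 : 0 <= MA) by exact (Rle_trans _ _ _ (norm_ge_0 _) Hw2).
  set (a := Rpower t (r - 1)). set (b := Rpower t (r - 2)).
  assert (Ha : 0 < a) by apply exp_pos.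
  assert (Hb : 0 < b) by apply exp_pos.
  assert (Eb : Rpower t (2 * r - 3) = a * b).
  { unfold a, b. rewrite <- Rpower_plus. f_equal. ring. }
  assert (Eab : a = b * t).
  { unfold a, b. rewrite <- (Rpower_1 t) at 3 by auto. rewrite <- Rpower_plus. f_equal. ring. }
  (* The cubic interpolation remainder is of order a^3 = t^(3r-3); trading its factor t^r for T^r
     brings it to the common order a b = t^(2r-3). *)
  assert (Ea3 : a ^ 3 <= Rpower T r * (a * b)).
  { replace (a ^ 3) with (a * (b * t) * a) by (rewrite <- Eab; ring).
    replace (a * (b * t) * a) with (t * a * (a * b)) by ring.
    assert (t * a = Rpower t r) as ->.
    { unfold a. rewrite <- (Rpower_1 t) at 1 by auto. rewrite <- Rpower_plus. f_equal. ring. }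
    apply Rmult_le_compat_r; [nra|]. apply Rle_Rpower_l; lra. }
  assert (HD : forall s u, t <= s <= t + tau -> t <= u <= t + tau ->
    Rabs (rpow s r - rpow u r) <= a * tau).
  { intros s u Hs Hu. rewrite !rpow_pos_eq by lra.
    eapply Rle_trans; [apply (Rpower_increment_le t (t + tau)); auto|].
    apply Rmult_le_compat_l; [lra|]. apply Rabs_le. lra. }
  assert (HL : forall s u, t <= s <= t + tau -> t <= u <= t + tau ->
    Rabs (rpow s r - rpow u r - r * a * (s - u)) <= b * tau ^ 2).
  { intros s u Hs Hu. rewrite !rpow_pos_eq by lra.
    eapply Rle_trans; [apply (Rpower_increment_linear t tau); auto|].
    replace (b * tau ^ 2) with (b * tau * tau) by ring.
    apply Rmult_le_compat_l; [nra|]. apply Rabs_le. lra. }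
  assert (Hp1 : t <= t + c1 * tau <= t + tau) by nra.
  assert (Hp2 : t <= t + c2 * tau <= t + tau) by nra.
  set (K := M * (2 * M3 * Rpower T r + M2 + MA * T) * (a * b * tau ^ 3)).
  (* The quadratic coefficient with s^r replaced by its linearisation of slope r a at t; subtracting
     [scal (q s) v] leaves the integral unchanged. *)
  set (q := fun s => / 2 * (r * a) ^ 2 * ((s - t - c1 * tau) * (s - t - c2 * tau))).
  assert (Hpt : forall s, t <= s <= t + tau ->
    norm (minus (S (t + tau - s) (interp_defect t tau s)) (scal (q s) v)) <= K).
  { intros s Hs.
    set (k0 := / 2 * ((rpow s r - p1) * (rpow s r - p2))).
    set (g := interp_defect t tau s).
    assert (HE : norm (minus g (scal k0 v)) <= 2 * M3 * (a * tau) ^ 3)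
      by exact (interp_defect_le t tau s (a * tau) ltac:(lra) Htau
                  (HD _ _ Hs Hp1) (HD _ _ Hp2 Hp1)).
    assert (HE' : 2 * M3 * (a * tau) ^ 3 <= 2 * M3 * Rpower T r * (a * b * tau ^ 3)).
    { assert (0 <= tau ^ 3) by (apply pow_le; lra).
      rewrite Rpow_mult_distr.
      replace (2 * M3 * Rpower T r * (a * b * tau ^ 3))
        with (2 * M3 * (Rpower T r * (a * b) * tau ^ 3)) by ring.
      apply Rmult_le_compat_l; [lra|]. now apply Rmult_le_compat_r. }
    assert (Hk : Rabs (k0 - q s) <= a * b * tau ^ 3).
    (* Difference of two products, x y - x' y' = x (y - y') + (x - x') y', so each term has one
       factor of size a tau and one linearisation error of size b tau^2. *)
    { replace (k0 - q s) with
        (/ 2 * ((rpow s r - p1) * (rpow s r - p2 - r * a * (s - (t + c2 * tau)))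
          + (rpow s r - p1 - r * a * (s - (t + c1 * tau))) * (r * a * (s - t - c2 * tau))))
        by (unfold k0, q; ring).
      rewrite Rabs_mult, (Rabs_right (/ 2)) by lra.
      assert (B1 : Rabs ((rpow s r - p1) * (rpow s r - p2 - r * a * (s - (t + c2 * tau))))
               <= (a * tau) * (b * tau ^ 2)).
      { rewrite Rabs_mult. apply Rmult_le_compat; auto using Rabs_pos;
          [now apply HD | now apply HL]. }
      assert (B2 : Rabs ((rpow s r - p1 - r * a * (s - (t + c1 * tau))) * (r * a * (s - t - c2 * tau)))
               <= (b * tau ^ 2) * (a * tau)).
      { rewrite Rabs_mult. apply Rmult_le_compat; auto using Rabs_pos; [now apply HL|].
        rewrite Rabs_mult. apply Rmult_le_compat; auto using Rabs_pos.
        - rewrite Rabs_right; nra.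
        - apply Rabs_le. nra. }
      match goal with |- / 2 * Rabs (?x + ?y) <= _ => pose proof (Rabs_triang x y) end.
      nra. }
    assert (Hq : Rabs (q s) <= a ^ 2 * tau ^ 2).
    { unfold q. rewrite !Rabs_mult, (Rabs_right (/ 2)), (Rabs_right ((r * a) ^ 2))
        by (try apply Rle_ge, pow2_ge_0; lra).
      assert (B1 : Rabs (s - t - c1 * tau) * Rabs (s - t - c2 * tau) <= tau * tau).
      { apply Rmult_le_compat; auto using Rabs_pos; apply Rabs_le; nra. }
      assert (B2 : (r * a) ^ 2 <= a ^ 2) by (apply pow_incr; nra).
      pose proof (pow2_ge_0 (r * a)).
      assert (0 <= Rabs (s - t - c1 * tau) * Rabs (s - t - c2 * tau))
        by (apply Rmult_le_pos; apply Rabs_pos).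
      assert ((r * a) ^ 2 * (Rabs (s - t - c1 * tau) * Rabs (s - t - c2 * tau)) <= a ^ 2 * (tau * tau))
        by (apply Rmult_le_compat; auto).
      nra. }
    set (u := t + tau - s).
    assert (Hu : 0 <= u <= T) by (unfold u; lra).
    assert (Hu' : u <= tau) by (unfold u; lra).
    assert (F1 : norm (S u (minus g (scal (q s) v)))
               <= M * ((2 * M3 * Rpower T r + M2) * (a * b * tau ^ 3))).
    { eapply Rle_trans; [apply (HM u _ Hu)|]. apply Rmult_le_compat_l; [lra|].
      assert (G1 : norm (scal (k0 - q s) v) <= a * b * tau ^ 3 * M2).
      { eapply Rle_trans; [refine (norm_scal_le _ _)|].
        apply Rmult_le_compat; auto using Rabs_pos. apply norm_ge_0. apply HM2, rpow_ge_0. }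
      replace (minus g (scal (q s) v))
        with (plus (minus g (scal k0 v)) (scal (k0 - q s) v)) by vector.
      eapply Rle_trans; [refine (norm_triangle _ _)|].
      eapply Rle_trans; [apply Rplus_le_compat; [exact HE | exact G1]|]. lra. }
    assert (F2 : norm (scal (q s) (minus (S u v) v)) <= M * (MA * T * (a * b * tau ^ 3))).
    { eapply Rle_trans; [refine (norm_scal_le _ _)|].
      assert (G1 : norm (minus (S u v) v) <= M * tau * MA).
      { eapply Rle_trans; [apply (semigroup_generator_le S HS T M v w HM ltac:(lra) Hw1 u Hu)|].
        apply Rmult_le_compat; auto; [nra | apply norm_ge_0 | nra]. }
      apply Rle_trans with (a ^ 2 * tau ^ 2 * (M * tau * MA)).
      - apply Rmult_le_compat; auto using Rabs_pos. apply norm_ge_0.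
      (* Here a^2 = a b t with t <= T, and the extra tau gained from the generator completes a b
         tau^3. *)
      - replace (a ^ 2) with (a * (b * t)) by (rewrite <- Eab; ring).
        replace (a * (b * t) * tau ^ 2 * (M * tau * MA)) with (M * MA * (a * b * tau ^ 3) * t) by ring.
        replace (M * (MA * T * (a * b * tau ^ 3))) with (M * MA * (a * b * tau ^ 3) * T) by ring.
        apply Rmult_le_compat_l; [|lra].
        assert (0 <= tau ^ 3) by (apply pow_le; lra).
        apply Rmult_le_pos; [nra|]. apply Rmult_le_pos; nra. }
    replace (minus (S u g) (scal (q s) v))
      with (plus (S u (minus g (scal (q s) v))) (scal (q s) (minus (S u v) v))).
    - eapply Rle_trans; [refine (norm_triangle _ _)|].
      eapply Rle_trans; [apply Rplus_le_compat; [exact F1 | exact F2]|]. unfold K. lra.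
    - rewrite semigroup_minus by (auto; tauto). destruct HS as (_ & Hs' & _).
      rewrite Hs' by tauto. set (gg := S u g). set (vv := S u v). vector. }
  set (I := RInt (fun s => S (t + tau - s) (interp_defect t tau s)) t (t + tau)).
  assert (HI : is_RInt (fun s => minus (S (t + tau - s) (interp_defect t tau s)) (scal (q s) v))
                 t (t + tau) (minus I zero)).
  { apply (is_RInt_minus (V := CompleteNormedModule.NormedModule R_AbsRing X)).
    - apply (RInt_correct (V := X)).
      apply (duhamel_ex_RInt S HS (interp_defect t tau)); [|lra]. apply interp_defect_continuous.
    - apply quadrature_kernel_RInt. }
  replace (minus I zero) with I in HI by vector.
  eapply Rle_trans; [exact (norm_RInt_le_const _ t (t + tau) _ _ ltac:(lra) Hpt HI)|].
  apply Req_le. unfold K. rewrite Eb. ring.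
Qed.

Lemma local_error_le (n : nat) tau : 0 < tau -> (INR n + 1) * tau <= T ->
  norm (RInt (fun s => S (INR n * tau + tau - s) (interp_defect (INR n * tau) tau s))
          (INR n * tau) (INR n * tau + tau))
    <= M * (2 * M3 * Rpower T r + M2 + MA * T) * Rpower tau (1 + 2 * r) * step_weight r n.
Proof.
  intros Htau HnT.
  assert (MA0 : 0 <= MA).
  { destruct (HMA 0 (Rle_refl 0)) as [w [_ Hw]]. exact (Rle_trans _ _ _ (norm_ge_0 _) Hw). }
  destruct n as [|n].
  - simpl INR in *. simpl step_weight. rewrite Rmult_0_l, Rmult_1_r.
    eapply Rle_trans; [apply local_error_first; lra|].
    apply Rmult_le_compat_r; [apply Rlt_le, exp_pos|].
    apply Rmult_le_compat_l; [lra|]. nra.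
  - assert (Hn : 0 < INR (Datatypes.S n)) by (apply lt_0_INR; lia).
    unfold step_weight. set (N := INR (Datatypes.S n)) in *.
    eapply Rle_trans; [apply local_error_later; nra|].
    apply Req_le. rewrite (Rmult_assoc _ (Rpower tau (1 + 2 * r))). f_equal.
    rewrite <- Rpower_mult_distr by auto.
    rewrite <- (Rpower_pow 4) by auto.
    rewrite Rmult_assoc, <- Rpower_plus, Rmult_comm. f_equal. f_equal. simpl. ring.
Qed.

End LocalError.

(** * Propagation and summation of the local errors *)

Theorem theorem3
  (X : CompleteNormedModule R_AbsRing) (S : R -> X -> X)
  (T r c1 c2 : R) (y0 : X) (h h1 h2 h3 : R -> X) :
  C0_semigroup S ->
  0 < T -> 0 < r < 1 ->
  0 <= c1 <= 1 -> 0 <= c2 <= 1 -> c1 <> c2 ->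
  / 3 - / 2 * (c1 + c2) + c1 * c2 = 0 ->
  deriv_on_nonneg h h1 -> deriv_on_nonneg h1 h2 -> deriv_on_nonneg h2 h3 ->
  bounded_on_nonneg h1 -> bounded_on_nonneg h2 -> bounded_on_nonneg h3 ->
  (exists M, forall x, 0 <= x -> exists Ah2x, gen_graph S (h2 x) Ah2x /\ norm Ah2x <= M) ->
  exists C : R, forall (N n : nat), (0 < N)%nat -> (n <= N)%nat ->
    let tau := T / INR N in
    norm (minus (mild_sol S h r y0 (INR n * tau)) (eqrf2 S h r c1 c2 tau y0 n))
      <= C * Rpower tau (1 + 2 * r).
Proof.
  intros HS HT Hr Hc1 Hc2 Hc Hquad E1 E2 E3 _ [M2 HM2] [M3 HM3] [MA HMA].
  apply has_deriv_nonneg_of_deriv in E1, E2, E3.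
  destruct (semigroup_bounded S HS T) as (M & HM1 & HM).
  destruct (step_weight_sum_bounded r Hr) as (B & W & B0 & BW & Bstep).
  assert (M30 : 0 <= M3) by exact (Rle_trans _ _ _ (norm_ge_0 _) (HM3 0 (Rle_refl 0))).
  assert (M20 : 0 <= M2) by exact (Rle_trans _ _ _ (norm_ge_0 _) (HM2 0 (Rle_refl 0))).
  assert (MA0 : 0 <= MA).
  { destruct (HMA 0 (Rle_refl 0)) as [w [_ Hw]]. exact (Rle_trans _ _ _ (norm_ge_0 _) Hw). }
  set (K := M * (2 * M3 * Rpower T r + M2 + MA * T)).
  assert (HK : 0 <= K).
  { assert (0 < Rpower T r) by apply exp_pos.
    apply Rmult_le_pos; [lra|]. assert (0 <= M3 * Rpower T r) by nra. nra. }
  (* K bounds the local errors and already contains the M of the semigroup under the integral; the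
     outer M pays for their propagation, and W bounds the sum of the weights. *)
  exists (M * K * W). intros N n HN HnN tau.
  assert (HN' : 0 < INR N) by now apply lt_0_INR.
  assert (Htau : 0 < tau) by (apply Rdiv_lt_0_compat; lra).
  assert (HNtau : INR N * tau = T) by (unfold tau; field; lra).
  assert (Hgrid : forall k, (k <= N)%nat -> INR k * tau <= T).
  { intros k Hk. apply le_INR in Hk. nra. }
  set (rho := Rpower tau (1 + 2 * r)).
  assert (Hrho : 0 < rho) by apply exp_pos.
  (* The additional propagation by m steps is what keeps M from being raised to the power n: passing
     from n to n + 1 uses the hypothesis at m + 1, since [S (m tau)] after [S tau] is
     [S ((m + 1) tau)], and applies M only to the new local error. *)
  assert (Hn : forall n m, (n + m <= N)%nat ->
    norm (S (INR m * tau) (minus (mild_sol S h r y0 (INR n * tau)) (eqrf2 S h r c1 c2 tau y0 n)))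
      <= M * K * rho * B n).
  { clear n HnN. induction n as [|n IH]; intros m Hnm.
    - simpl eqrf2. rewrite B0, Rmult_0_r.
      replace (mild_sol S h r y0 (INR 0 * tau)) with y0.
      + eapply Rle_trans.
        * apply HM. split; [|apply Hgrid; lia]. apply Rmult_le_pos; [apply pos_INR | lra].
        * rewrite norm_minus_diag. lra.
      + simpl INR. rewrite Rmult_0_l. unfold mild_sol. rewrite (RInt_point (V := X)).
        destruct HS as (_ & _ & _ & H0 & _). rewrite H0. vector.
    - specialize (IH (Datatypes.S m) ltac:(lia)). rewrite S_INR in IH.
      pose proof (Hgrid (n + 1 + m)%nat ltac:(lia)) as Hg. rewrite !plus_INR in Hg. simpl INR in Hg.
      pose proof (pos_INR n). pose proof (pos_INR m).
      rewrite S_INR. replace ((INR n + 1) * tau) with (INR n * tau + tau) by ring.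
      change (eqrf2 S h r c1 c2 tau y0 (Datatypes.S n))
        with (eqrf2_step S h r c1 c2 tau (INR n * tau) (eqrf2 S h r c1 c2 tau y0 n)).
      rewrite eqrf2_error_step; auto; [|nra|].
      2:{ intros s. now apply (h_rpow_continuous h h1). }
      set (e := minus (mild_sol S h r y0 (INR n * tau)) (eqrf2 S h r c1 c2 tau y0 n)) in *.
      pose proof (local_error_le S HS h h1 h2 h3 T r c1 c2 M M2 M3 MA Hr Hc1 Hc2 Hc HM1 HM
                    E1 E2 E3 HM2 HM3 HMA Hquad n tau Htau ltac:(nra)) as HI.
      fold K rho in HI. unfold interp_defect in HI.
      match type of HI with norm ?i <= _ => set (I := i) in * end.
      assert (Hm : 0 <= INR m * tau <= T) by nra.
      destruct HS as (Hp & _ & _ & _ & Ha & _).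
      rewrite Hp by tauto. rewrite <- Ha by lra.
      replace (INR m * tau + tau) with ((INR m + 1) * tau) by ring.
      eapply Rle_trans; [refine (norm_triangle _ _)|].
      apply Rle_trans with (M * K * rho * B n + M * (K * rho * step_weight r n)).
      + apply Rplus_le_compat; [exact IH|].
        eapply Rle_trans; [apply HM; exact Hm|]. apply Rmult_le_compat_l; [lra | exact HI].
      + replace (M * K * rho * B n + M * (K * rho * step_weight r n))
          with (M * K * rho * (B n + step_weight r n)) by ring.
        apply Rmult_le_compat_l; [|apply Bstep].
        apply Rmult_le_pos; [nra | lra]. }
  (* Taking m = 0, where [S 0] is the identity, recovers the error itself. *)
  specialize (Hn n O ltac:(lia)). simpl (INR 0) in Hn. rewrite Rmult_0_l in Hn.
  destruct HS as (_ & _ & _ & H0 & _). rewrite H0 in Hn.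
  eapply Rle_trans; [exact Hn|].
  replace (M * K * W * rho) with (M * K * rho * W) by ring.
  apply Rmult_le_compat_l; [|apply BW]. apply Rmult_le_pos; [nra | lra].
Qed.
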